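(* Let $V$ be a finite-dimensional inner product space. Suppose that $\gamma:[0,l]\to V$ is parameterised at unit speed and is three times continuously differentiable (under this parameterisation). Let $\mu$ denote the finite Borel measure on $\mathbb{R}_+$ which is absolutely continuous with respect to the Lebesgue measure $\lambda$ on $\mathbb{R}_+$, with density given by $\frac{d\mu}{d\lambda}(t)=l^2|\gamma''_{tl}|^2\mathbf{1}_{[0,1]}(t)$ a.e. Then: (i) There exists a unique continuous function $\psi:[0,1]\to\mathbb{R}$ which solves, in the distributional sense, the second-order differential equation $$\psi''=2\psi\mu,\qquad \text{with }\psi_0=0,\quad \psi'_0=1.$$ (ii) This solution satisfies $$\psi_1^{-l/4}=\mathbb{E}\left[\exp\left(-\int_0^1(B_{0,t})^2\,\mu(dt)\right)\right]^{1/2}=c(\gamma),$$ where $(B_{0,t})_{t\in[0,1]}$ is a Brownian bridge starting at $0$ and returning to $0$ at time $1$, and $c(\gamma)$ is the Hambly-Lyons limit of $\gamma$.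
   Context: Unit speed means $|\gamma'_s|=1$ for all $s\in[0,l]$, so that $l$ is the length of $\gamma$. The Hambly-Lyons limit of a three times continuously differentiable unit-speed curve $\gamma:[0,l]\to V$ is $$c(\gamma):=\mathbb{E}\left[\exp\left(\int_0^l(\beta_s)^2\langle\gamma'_s,\gamma'''_s\rangle\,ds\right)\right]^{1/2},$$ where $(\beta_s)_{s\in[0,l]}$ is a Brownian bridge starting at $0$ and returning to zero at time $l$. In the differential equation, $\psi\mu$ denotes the measure with density $\psi$ with respect to $\mu$.
   Formalization: The exponent in (ii) is corrected: the formal theorem proves ψ_1^{-1/4} in place of the printed ψ_1^{-l/4}, which is false for l≠1 unless γ is straight (e.g. a circle arc); both agree when l=1. *)

(* Defs.v *)
From HB Require Import structures.
From mathcomp Require Export all_boot all_order all_algebra.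
From mathcomp Require Export all_classical all_reals all_analysis.
Export Order.TTheory GRing.Theory Num.Theory.
Export numFieldNormedType.Exports.

#[export] Set Implicit Arguments.
#[export] Unset Strict Implicit.
#[export] Unset Printing Implicit Defensive.

Local Open Scope classical_set_scope.
Local Open Scope ring_scope.

(* Curves on [0, l] are total functions on R of which only the values on [0, l]
   matter.  Derivatives are therefore taken relative to a set [A]: for
   [A = `[0, l]] they are two-sided in ]0, l[ and one-sided at 0 and l. *)
Section relative_derivative.
Context {R : realType} {V : normedModType R}.
Implicit Types (A : set R) (f : R -> V).

Definition diff_quot f (x y : R) : V := (y - x)^-1 *: (f y - f x).

Definition derivable_on A f : Prop :=
  forall x, A x -> cvg (diff_quot f x y @[y --> within A x^']).

Definition derive_on A f : R -> V :=
  fun x => lim (diff_quot f x y @[y --> within A x^']).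

Definition derive_on_n A n f : R -> V := iter n (derive_on A) f.

Definition continuously_derivable_on A n f : Prop :=
  (forall k, (k < n)%N -> derivable_on A (derive_on_n A k f)) /\
  {within A, continuous (derive_on_n A n f)}.

End relative_derivative.

Definition finite_dimensional {R : realType} (V : lmodType R) : Prop :=
  exists (n : nat) (e : 'I_n -> V),
    forall v : V, exists a : 'I_n -> R, v = \sum_(i < n) a i *: e i.

(* A measure on the half-line is regarded as a measure on R whose density
   vanishes on the negative numbers. *)
Definition has_lebesgue_density {R : realType}
    (mu : {measure set (measurableTypeR R) -> \bar R}) (f : R -> R) : Prop :=
  forall A, measurable A ->
    mu A = (\int[@lebesgue_measure R]_(t in A) (f t)%:E)%E.

(* Smooth functions with compact support contained in the open interval ]a, b[ *)
Definition test_function {R : realType} (a b : R) (phi : R -> R) : Prop :=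
  [/\ forall n (x : R), derivable (derive1n n phi) x 1,
      compact (closure [set x | phi x != 0]) &
      closure [set x | phi x != 0] `<=` `]a, b[ ].

(* psi : [0, 1] -> R is continuous and solves psi'' = 2 psi mu on ]0, 1[ in the
   sense of distributions, with psi_0 = 0 and psi'_0 = 1: the pairing of a test
   function phi with psi'' is the integral of psi phi'', and its pairing with the
   signed measure 2 psi mu is the integral of 2 phi psi against mu.  The
   derivative of psi at 0 is its right derivative. *)
Definition solves_ode {R : realType}
    (mu : {measure set (measurableTypeR R) -> \bar R}) (psi : R -> R) : Prop :=
  [/\ {within `[0, 1], continuous psi},
      psi 0 = 0,
      (psi t - psi 0) / t @[t --> 0^'+] --> (1 : R) &
      forall phi, test_function 0 1 phi ->
        \int[@lebesgue_measure R]_(t in `]0, 1[) (psi t * derive1n 2 phi t) =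
        \int[mu]_(t in `]0, 1[) (phi t * (2 * psi t))].

(* Degenerate Gaussians (point masses) have to be allowed separately:
   [normal_prob m 0] is not the Dirac mass at m. *)
Definition gaussian {d} {T : measurableType d} {R : realType}
    (P : probability T R) (X : T -> R) : Prop :=
  exists m : R,
    (forall A : set (measurableTypeR R),
       measurable A -> pushforward P X A = \d_m A) \/
    (exists2 s : R, 0 < s &
      forall A : set (measurableTypeR R),
        measurable A -> pushforward P X A = normal_prob m s A).

(* Brownian bridge (B_t), t in [0, l], starting at 0 and returning to 0 at time
   l: the almost surely continuous centred Gaussian process with covariance
   min(s, t) - s t / l. *)
Definition brownian_bridge {d} {T : measurableType d} {R : realType}
    (P : probability T R) (l : R) (B : R -> {RV P >-> R}) : Prop :=
  [/\ forall n (t : 'I_n -> R) (a : 'I_n -> R),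
        (forall i, t i \in `[0, l]) ->
        gaussian P (fun w => \sum_(i < n) a i * B (t i) w),
      forall t, t \in `[0, l] -> ('E_P[B t] = 0)%E,
      forall s t, s \in `[0, l] -> t \in `[0, l] ->
        covariance P (B s) (B t) = (Num.min s t - s * t / l)%:E &
      {ae P, forall w, {within `[0, l], continuous (fun t => B t w)}}].

(* The Hambly-Lyons limit of gamma : [0, l] -> V, for the inner product ip and
   a Brownian bridge beta on [0, l]. *)
Definition hambly_lyons {d} {T : measurableType d} {R : realType}
    {V : normedModType R} (ip : V -> V -> R) (P : probability T R) (l : R)
    (beta : R -> {RV P >-> R}) (gamma : R -> V) : \bar R :=
  ('E_P[fun w => expR (\int[@lebesgue_measure R]_(s in `[0, l])
      ((beta s w) ^+ 2 * ip (derive_on_n `[0, l] 1 gamma s)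
                            (derive_on_n `[0, l] 3 gamma s)))%R]
   `^ (2^-1))%E.

(* Main.v *)
From HB Require Import structures.
Require Import Defs.
From mathcomp Require Import measurable_realfun ring lra zify.

(** The density q of mu on [0, 1] is continuous and nonnegative, and the equation
    psi'' = 2 psi mu with psi 0 = 0 and psi' 0 = 1 is equivalent to the integral
    equation

      psi t = t + the double primitive of 2 q psi at t.

    One direction is an integration by parts against the test function.  For
    the other, psi minus the double primitive has zero second derivative in the
    sense of distributions, hence is affine ([affine_of_test]), and the initial
    conditions identify it with t ([volterra_of_solves_ode]).  The integral
    operator is a contraction for an exponentially weighted norm, which gives
    existence and uniqueness ([volterra_fixpoint], [volterra_fixpoint_unique]);
    since q is nonnegative, psi t >= t, so psi 1 >= 1.

    The heart of the matter is the formula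

      E exp (- int_0^1 B_t^2 q(t) dt) = psi(1)^(-1/2)

    for a Brownian bridge B on [0, 1] ([bridge_laplace]).  It is proved by
    discretization.  Weight the law of the bridge by the factors
    exp (- c_k B(t_k)^2), one sampling time after the other.  Each factor is a
    mean of cosines, exp (- c y^2) = E cos (sqrt (2 c) y Z) with Z standard
    normal, and therefore keeps the law Gaussian: it changes the covariance K by
    the rank-one update K - 2 c K_m K_m^T / (1 + 2 c K_mm) and multiplies the mass
    by (1 + 2 c K_mm)^(-1/2) ([gaussian_damping]).  For the covariance
    s (1 - t), s <= t, of the bridge, the updated covariance at the later times
    has the form p(s) (1 - t) / p(1) with p affine, and the product of the
    factors 1 + 2 c K_mm so far is p(1); each update bends p by the rule of an
    Euler scheme for psi'' = 2 q psi ([bridge_damps]).  Hence the discrete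
    expectation is exactly the power -1/2 of the final value of that scheme.  As
    the mesh tends to 0, the scheme converges to psi 1 ([euler_cvg]), the sums
    converge to the integral on every continuous path, and dominated
    convergence concludes.

    For the Hambly-Lyons limit, differentiating |gamma'|^2 = 1 twice shows that
    the inner product of gamma' and gamma''' is - |gamma''|^2
    ([unit_speed_third_derivative]), and t |-> beta(t l) / sqrt l is a Brownian
    bridge on [0, 1] ([bridge_rescale]).  The substitution s = t l then turns the
    exponent defining the limit into the one above, with
    q t = l^2 |gamma''(t l)|^2.  Both expectations are psi(1)^(-1/2), and their
    square roots psi(1)^(-1/4). *)

Local Open Scope classical_set_scope.
Local Open Scope ring_scope.

(** * Calculus on an interval *)

(** The base point of the integrals stays strictly to the left of both 0 and x:
a fundamental theorem of calculus for integrals with a fixed left end then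
applies at every real x, and no case distinction on the sign of x remains. *)
Definition prim {R : realType} (f : R -> R) (x : R) : R :=
  let a := Num.min x 0 - 1 in
  \int[@lebesgue_measure R]_(t in `[a, x]) f t -
  \int[@lebesgue_measure R]_(t in `[a, 0]) f t.

Lemma continuous_integrable_itv {R : realType} (f : R -> R) (a b : R) :
  {within `[a, b], continuous f} ->
  (@lebesgue_measure R).-integrable `[a, b] (EFin \o f).
Proof.
move=> cf; apply: continuous_compact_integrable => //.
exact: segment_compact.
Qed.

Lemma continuous_integrable {R : realType} (f : R -> R) (b0 b1 : bool) (a b : R) :
  continuous f ->
  (@lebesgue_measure R).-integrable
    [set` Interval (BSide b0 a) (BSide b1 b)] (EFin \o f).
Proof.
move=> cf; have := continuous_integrable_itv (@continuous_subspaceT _ _ `[a, b] f cf).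
apply: integrableS => //.
by apply: subset_itvScc; [case: b0|case: b1]; rewrite bnd_simp.
Qed.

(** Moving the base point changes both integrals by the same amount, so near any
given x the base point can be kept constant. *)
Lemma primE {R : realType} (f : R -> R) (a x : R) : continuous f ->
  a < 0 -> a < x ->
  prim f x = \int[@lebesgue_measure R]_(t in `[a, x]) f t -
             \int[@lebesgue_measure R]_(t in `[a, 0]) f t.
Proof.
move=> cf.
have key (c d y : R) : c < d -> d < y ->
  \int[@lebesgue_measure R]_(t in `[c, y]) f t =
  \int[@lebesgue_measure R]_(t in `[c, d]) f t +
  \int[@lebesgue_measure R]_(t in `]d, y]) f t.
  move=> cd dy; rewrite -(@Rintegral_itvB _ f (BLeft c) (BRight y) d).
  - by rewrite addrC subrK.
  - exact: continuous_integrable.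
  - by rewrite bnd_simp ltW.
  - by rewrite bnd_simp ltW.
have key2 (c d : R) : c < d -> d < 0 -> d < x ->
  \int[@lebesgue_measure R]_(t in `[c, x]) f t -
  \int[@lebesgue_measure R]_(t in `[c, 0]) f t =
  \int[@lebesgue_measure R]_(t in `[d, x]) f t -
  \int[@lebesgue_measure R]_(t in `[d, 0]) f t.
  move=> cd d0 dx; rewrite (key c d x)// (key c d 0)//.
  rewrite !Rintegral_itv_obnd_cbnd; [|exact: continuous_integrable..].
  by rewrite opprD addrACA subrr add0r.
move=> a0 ax; rewrite /prim; set b := Num.min x 0 - 1.
have [bx b0] : b < x /\ b < 0.
  by rewrite /b; split; rewrite ltrBlDr gt_min ?ltrDl ltr01 ?orbT.
have [ab|ba|->] := ltgtP a b; last by [].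
- exact/esym/key2.
- exact: key2.
Qed.

Lemma prim0 {R : realType} (f : R -> R) : prim f 0 = 0.
Proof. by rewrite /prim subrr. Qed.

Lemma is_derive_prim {R : realType} (f : R -> R) (x : R) : continuous f ->
  is_derive x 1 (prim f) (f x).
Proof.
move=> cf; pose a := Num.min x 0 - 2; pose u := x + 1.
have [ax a0] : a + 1 < x /\ a < 0.
  have mx : Num.min x 0 <= x by rewrite ge_min lexx.
  have m0 : Num.min x 0 <= 0 by rewrite ge_min lexx orbT.
  by rewrite /a; split; lra.
have fE : is_derive x 1
    (fun y => \int[@lebesgue_measure R]_(t in `[a, y]) f t -
      \int[@lebesgue_measure R]_(t in `[a, 0]) f t) (f x).
  have [||||d1 d2] := @continuous_FTC1_closed R f a x u.
  - by rewrite /u ltrDl.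
  - exact: continuous_integrable.
  - by lra.
  - exact: cf.
  rewrite -[f x]subr0; apply: is_deriveB.
  rewrite -d2 derive1E; exact: derivableP.
apply: near_eq_is_derive fE.
near=> y; rewrite -primE//.
near: y; apply: lt_nbhsr; lra.
Unshelve. all: by end_near. Qed.

Lemma continuous_prim {R : realType} (f : R -> R) : continuous f -> continuous (prim f).
Proof.
move=> cf x; apply: differentiable_continuous; apply/derivable1_diffP.
by have [] := is_derive_prim x cf.
Qed.

Lemma is_derive_continuous {R : realType} (F f : R -> R) :
  (forall x : R, is_derive x 1 F (f x)) -> continuous F.
Proof.
move=> dF x; apply: differentiable_continuous; apply/derivable1_diffP.
by have [] := dF x.
Qed.

Lemma ger0_is_derive_le {R : realType} (F f : R -> R) (a b : R) : a <= b ->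
  (forall x : R, is_derive x 1 F (f x)) ->
  (forall x, a <= x <= b -> 0 <= f x) -> F a <= F b.
Proof.
move=> ab dF f0; have cF := is_derive_continuous dF.
have [|c cab] := @MVT_segment R F f a b ab (fun x _ => dF x).
  exact: continuous_subspaceT.
move: cab; rewrite in_itv/= => cab E.
by rewrite -subr_ge0 E mulr_ge0 ?f0// subr_ge0.
Qed.

Lemma is_derive_le {R : realType} (F f G g : R -> R) (a b : R) : a <= b ->
  (forall x : R, is_derive x 1 F (f x)) ->
  (forall x : R, is_derive x 1 G (g x)) ->
  (forall x, a <= x <= b -> f x <= g x) -> F b - F a <= G b - G a.
Proof.
move=> ab dF dG fg.
have d (x : R) : is_derive x 1 (fun y => G y - F y) (g x - f x) by exact: is_deriveB.
have := ger0_is_derive_le ab d.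
have H x : a <= x <= b -> 0 <= g x - f x by rewrite subr_ge0; exact: fg.
by move=> /(_ H) /= ?; lra.
Qed.

Lemma is_derive_unique {R : realType} (F G f : R -> R) :
  (forall x : R, is_derive x 1 F (f x)) ->
  (forall x : R, is_derive x 1 G (f x)) -> forall a b, F b - F a = G b - G a.
Proof.
move=> dF dG a b.
have [ab|/ltW ab] := leP a b; apply/eqP; rewrite eq_le; apply/andP; split.
- exact: is_derive_le dF dG _.
- exact: is_derive_le dG dF _.
- rewrite -lerN2 !opprB. exact: is_derive_le dG dF _.
- rewrite -lerN2 !opprB. exact: is_derive_le dF dG _.
Qed.

Lemma Rintegral_is_derive {R : realType} (F f : R -> R) (a b : R) : a <= b ->
  continuous f -> (forall x : R, is_derive x 1 F (f x)) ->
  \int[@lebesgue_measure R]_(x in `[a, b]) f x = F b - F a.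
Proof.
move=> ab cf dF; pose c := Num.min a 0 - 1.
have [ca c0] : c < a /\ c < 0.
  by rewrite /c; split; rewrite ltrBlDr gt_min ?ltrDl ltr01 ?orbT.
rewrite (is_derive_unique dF (fun x => is_derive_prim x cf)).
rewrite (primE cf c0 ca) (primE cf c0 (lt_le_trans ca ab)).
rewrite opprB addrA addrNK.
rewrite (@Rintegral_itvB _ f (BLeft c) (BRight b) a) ?bnd_simp//.
- rewrite Rintegral_itv_obnd_cbnd//.
  exact: continuous_integrable.
- exact: continuous_integrable.
- exact: ltW.
Qed.

Lemma unif_continuous_itv {R : realType} (f : R -> R) (a b e : R) :
  continuous f -> 0 < e ->
  exists2 d, 0 < d & forall x y, x \in `[a, b] -> `|x - y| < d ->
    `|f x - f y| <= e.
Proof.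
move=> cf e0.
have /compact_near_coveringP cover := @segment_compact R a b.
have [] := cover _ (0^'+) (fun d x => forall y, `|x - y| < d ->
    `|f x - f y| <= e).
  move=> x _.
  have /cvgrPdist_le/(_ (e / 2))[|r /= r0 fr] := cf x; first by rewrite divr_gt0.
  near=> z d => y /= zyd.
  have xz : `|x - z| < r / 2 by near: z; apply: nbhsx_ballx; rewrite divr_gt0.
  have dr : d < r / 2 by near: d; apply: nbhs_right_lt; rewrite divr_gt0.
  have fx : `|f x - f z| <= e / 2 by apply: fr => /=; lra.
  have fy : `|f x - f y| <= e / 2.
    by apply: fr => /=; have := ler_distD z x y; lra.
  by have := ler_distD (f x) (f z) (f y); rewrite (distrC (f z) (f x)); lra.
move=> d /= d0 fd; exists (d / 2); first by rewrite divr_gt0.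
move=> x y xab xy; apply: (fd (d / 2)) => //=; last by rewrite divr_gt0.
by rewrite sub0r normrN gtr0_norm ?divr_gt0// ltr_pdivrMr// ltr_pMr// ltr1n.
Unshelve. all: by end_near. Qed.

(** Composing with [clamp a b] turns a function continuous within `[a, b] into a
function continuous on the line, to which [prim] applies. *)
Definition clamp {R : realType} (a b x : R) : R := Num.max a (Num.min b x).

Lemma clamp_itv {R : realType} (a b x : R) : a <= b -> clamp a b x \in `[a, b].
Proof.
by move=> ab; rewrite /clamp in_itv/= le_max lexx/= ge_max ab/= ge_min lexx.
Qed.

Lemma clamp_id {R : realType} (a b x : R) : x \in `[a, b] -> clamp a b x = x.
Proof.
by rewrite in_itv/= /clamp => /andP[ax xb]; rewrite min_r// max_r.
Qed.

Lemma clamp_continuous {R : realType} (a b : R) : continuous (clamp a b).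
Proof.
move=> x; rewrite /clamp.
apply: (@continuous_max _ _ (fun=> a) (fun x => Num.min b x)); first exact: cvg_cst.
by apply: (@continuous_min _ _ (fun=> b) id); [exact: cvg_cst|exact: cvg_id].
Qed.

Lemma continuous_clamp {R : realType} (a b : R) (f : R -> R) : a <= b ->
  {within `[a, b], continuous f} -> continuous (f \o clamp a b).
Proof.
move=> ab cf x.
have cx : `[a, b]%classic (clamp a b x) by exact: clamp_itv.
apply: (@cvg_comp _ _ _ (clamp a b) f _ _ _ _ (cf (clamp a b x))).
apply/subspace_cvgP => //.
move=> P NP; have := @clamp_continuous _ a b _ _ NP.
apply: (@filterS _ (nbhs x)) => y /=; apply; exact: clamp_itv.
Qed.

Lemma is_derive_expRM {R : realType} (l x : R) :
  is_derive x 1 (fun y : R => expR (l * y)) (l * expR (l * x)).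
Proof.
rewrite mulrC.
apply: (@is_derive1_comp _ expR (fun y => l * y)).
by have := @is_deriveZ R R R id l x 1 1 _; rewrite /GRing.scale/= mulr1; apply.
Qed.

(** Integration divides the weight [expR (l * x)] by l.  Measuring distances with
this weight, for large l, makes integral operators contracting without any
smallness assumption on the kernel. *)
Lemma prim_dist_le_expR {R : realType} (f g : R -> R) (K l : R) :
  continuous f -> continuous g -> 0 <= K -> 0 < l ->
  (forall x, 0 <= x <= 1 -> `|f x - g x| <= K * expR (l * x)) ->
  forall x, 0 <= x <= 1 -> `|prim f x - prim g x| <= K / l * expR (l * x).
Proof.
move=> cf cg K0 l0 fg x x01.
have dE (y : R) : is_derive y 1 (fun y => K / l * expR (l * y)) (K * expR (l * y)).
  have -> : K * expR (l * y) = K / l * (l * expR (l * y)).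
    by rewrite mulrA divfK// gt_eqF.
  exact: is_deriveZ (is_derive_expRM l y).
have [x0 x1] := andP x01.
have dfg (y : R) : is_derive y 1 (fun y => prim f y - prim g y) (f y - g y).
  by apply: is_deriveB; exact: is_derive_prim.
have dgf (y : R) : is_derive y 1 (fun y => prim g y - prim f y) (g y - f y).
  by apply: is_deriveB; exact: is_derive_prim.
have Kl : 0 <= K / l by rewrite divr_ge0// ltW.
have H y : 0 <= y <= x -> 0 <= y <= 1 by move=> /andP[-> yx]; exact: le_trans yx x1.
rewrite ler_norml; apply/andP; split.
- rewrite lerNl opprB.
  have := is_derive_le x0 dgf dE; rewrite !prim0 subrr subr0 mulr0 expR0 mulr1.
  move=> K'; apply: le_trans (K' _) _; last by rewrite gerBl.
  by move=> y /H /fg; rewrite distrC; apply: le_trans; exact: ler_norm.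
- have := is_derive_le x0 dfg dE; rewrite !prim0 subrr subr0 mulr0 expR0 mulr1.
  move=> K'; apply: le_trans (K' _) _; last by rewrite gerBl.
  by move=> y /H /fg; apply: le_trans; exact: ler_norm.
Qed.

Lemma continuous_bounded_itv {R : realType} (f : R -> R) (a b : R) : a <= b ->
  {within `[a, b], continuous f} ->
  exists2 K, 0 <= K & forall x, x \in `[a, b] -> `|f x| <= K.
Proof.
move=> ab cf; pose g (x : R) := `|f (clamp a b x)|.
have cg : continuous g.
  move=> x; apply: (@continuous_comp _ _ _ (f \o clamp a b) Num.norm).
    exact: continuous_clamp.
  exact: norm_continuous.
have [|m mab Hm] := @EVT_max R g a b ab; first exact: continuous_subspaceT.
exists (g m); first exact: normr_ge0.
by move=> x xab; have := Hm x xab; rewrite /g clamp_id.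
Qed.

Lemma is_derive_affine {R : realType} (a b x : R) :
  is_derive x 1 (fun y : R => a * y + b) a.
Proof.
have d1 := @is_deriveZ R R R id a x 1 1 _.
have := @is_deriveD R R R _ (cst b) x 1 _ 0 (d1 _) _.
by rewrite /GRing.scale/= mulr1 addr0; apply.
Qed.

Lemma is_derive_shift_arg {R : realType} (F f : R -> R) (a : R) :
  (forall x : R, is_derive x 1 F (f x)) ->
  forall x : R, is_derive x 1 (fun x => F (x - a)) (f (x - a)).
Proof.
move=> dF x; have := is_derive_affine 1 (- a) x; under eq_fun do rewrite mul1r.
by move=> /(is_derive1_comp (dF _)); rewrite mulr1.
Qed.

Lemma derive1_is_derive {R : realType} (f f' : R -> R) :
  (forall x : R, is_derive x 1 f (f' x)) -> derive1 f = f'.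
Proof. by move=> df; apply/funext => x; rewrite derive1E; exact: derive_val. Qed.

Lemma is_derive_0_eq {R : realType} (F f : R -> R) (a b : R) : a <= b ->
  (forall x : R, is_derive x 1 F (f x)) ->
  (forall x, a <= x <= b -> f x = 0) -> F b = F a.
Proof.
move=> ab dF f0.
have d0 (x : R) : is_derive x 1 (fun=> 0 : R) (0 : R) by exact: is_derive_cst.
have H1 := is_derive_le ab dF d0; have H2 := is_derive_le ab d0 dF.
have {}H1 : F b - F a <= 0 - 0 by apply: H1 => x /f0 ->.
have {}H2 : 0 - 0 <= F b - F a by apply: H2 => x /f0 ->.
lra.
Qed.

Lemma is_derive_increment {R : realType} (F f : R -> R) (a b y w : R) : a <= b ->
  (forall x : R, is_derive x 1 F (f x)) ->
  (forall x, a <= x <= b -> `|f x - y| <= w) ->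
  `|F b - F a - (b - a) * y| <= w * (b - a).
Proof.
move=> ab dF fy.
have dL k (x : R) : is_derive x 1 (fun x => k * x) k.
  by have := is_derive_affine k 0 x; under eq_fun do rewrite addr0.
have H1 := is_derive_le ab dF (dL (y + w)).
have H2 := is_derive_le ab (dL (y - w)) dF.
have {}H1 : F b - F a <= (y + w) * b - (y + w) * a.
  by apply: H1 => x /fy; rewrite ler_norml; lra.
have {}H2 : (y - w) * b - (y - w) * a <= F b - F a.
  by apply: H2 => x /fy; rewrite ler_norml; lra.
rewrite ler_norml; nra.
Qed.

(** The sum has n.+2 terms because both end points are sampling times; the extra
term at 0 is of order 1 / n. *)
Lemma riemann_sum_cvg {R : realType} (f : R -> R) : continuous f ->
  \sum_(k < n.+2) n.+1%:R^-1 * f (k%:R * n.+1%:R^-1) @[n --> \oo] -->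
  \int[@lebesgue_measure R]_(t in `[0, 1]) f t.
Proof.
move=> cf; rewrite (Rintegral_is_derive ler01 cf (fun x => is_derive_prim x cf)).
apply/cvgrPdist_le => e e0.
have [d d0 fd] := unif_continuous_itv 0 1 cf (divr_gt0 e0 (@ltr0n R 2)).
have inv0 : (n.+1%:R^-1 : R) @[n --> \oo] --> 0 by exact: cvg_harmonic.
have f00 : 0 <= `|f 0| by [].
have e1 : 0 < e / 2 / (`|f 0| + 1) by rewrite !divr_gt0// ltr_wpDl.
have /cvgrPdist_lt /(_ _ d0) H1 := inv0.
have /cvgrPdist_lt /(_ _ e1) H2 := inv0.
near=> n.
have dt0 : 0 < (n.+1%:R^-1 : R) by rewrite invr_gt0.
have : `|0 - (n.+1%:R^-1 : R)| < d by near: n.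
have : `|0 - (n.+1%:R^-1 : R)| < e / 2 / (`|f 0| + 1) by near: n.
rewrite !sub0r !normrN !(ger0_norm (ltW dt0)).
have ndt : n.+1%:R * (n.+1%:R^-1 : R) = 1 by rewrite mulfV.
set dt : R := n.+1%:R^-1 in dt0 ndt * => dte dtd.
have incr k : (k < n.+1)%N ->
  `|prim f (k.+1%:R * dt) - prim f (k%:R * dt) - dt * f (k.+1%:R * dt)| <= e / 2 * dt.
  move=> kn; have kE : k.+1%:R * dt - k%:R * dt = dt by rewrite -natr1; ring.
  have := @is_derive_increment _ (prim f) f (k%:R * dt) (k.+1%:R * dt) (f (k.+1%:R * dt)) (e / 2).
  rewrite kE; apply.
  - by rewrite -subr_ge0 kE ltW.
  - by move=> x; exact: is_derive_prim.
  move=> x /andP[x1 x2]; rewrite distrC; apply: fd.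
    rewrite in_itv/= mulr_ge0 ?(ltW dt0)//= -[leRHS]ndt ler_pM2r// ler_nat//.
  by rewrite ger0_norm ?subr_ge0//; lra.
have -> : prim f 1 - prim f 0 = \sum_(k < n.+1) (prim f (k.+1%:R * dt) - prim f (k%:R * dt)).
  by rewrite -(big_mkord xpredT (fun k => prim f (k.+1%:R * dt) - prim f (k%:R * dt))) telescope_sumr// ndt mul0r.
rewrite [X in _ - X]big_ord_recl mul0r opprD addrCA -sumrB.
rewrite (le_trans (ler_normD _ _))// normrN normrM (ger0_norm (ltW dt0)).
rewrite [leRHS](splitr e) lerD//.
  rewrite (le_trans (y := e / 2 / (`|f 0| + 1) * (`|f 0| + 1)))//.
    by rewrite ler_pM// ?(ltW dt0)// ?(ltW dte)// lerDl.
  by rewrite divfK// gt_eqF// ltr_wpDl.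
rewrite (le_trans (ler_norm_sum _ _ _))//.
rewrite (le_trans (y := \sum_(k < n.+1) e / 2 * dt))//.
  by apply: ler_sum => k _; exact: incr.
by rewrite sumr_const card_ord -[leLHS]mulr_natl mulrCA ndt mulr1.
Unshelve. all: end_near.
Qed.

Lemma Rintegral_rescale {R : realType} (l : R) (g : R -> R) : 0 < l -> continuous g ->
  \int[@lebesgue_measure R]_(s in `[0, l]) g s =
  \int[@lebesgue_measure R]_(t in `[0, 1]) (l * g (t * l)).
Proof.
move=> l0 cg.
have cl : continuous (fun t : R => t * l).
  by move=> t; apply: cvgM; [exact: cvg_id|exact: cvg_cst].
have dl (t : R) : is_derive t 1 (fun t : R => t * l) l.
  by have := is_derive_affine l 0 t; under eq_fun do rewrite addr0 mulrC.
rewrite (Rintegral_is_derive (ltW l0) cg (fun x => is_derive_prim x cg)).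
have cf : continuous (fun t : R => l * g (t * l)).
  by move=> t; apply: cvgM; [exact: cvg_cst|exact: (continuous_comp (cl t) (cg _))].
have dF (t : R) : is_derive t 1 (prim g \o (fun t => t * l)) (l * g (t * l)).
  rewrite mulrC.
  by apply: (@is_derive1_comp _ (prim g) (fun t => t * l)); exact: is_derive_prim.
by rewrite (Rintegral_is_derive ler01 cf dF)/= mul0r mul1r.
Qed.

(** * The integral equation *)

(** Integrating psi'' = 2 q psi twice from psi 0 = 0 and psi' 0 = 1 shows that the
solutions are the fixed points of this operator.  The clamping makes the value
at any real x depend on the values of u on `[0, 1] only. *)
Definition volterra {R : realType} (q u : R -> R) (x : R) : R :=
  clamp 0 1 x + prim (prim (fun s => 2 * q s * u s)) (clamp 0 1 x).

Lemma continuous_volterra_density {R : realType} (q u : R -> R) :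
  continuous q -> continuous u -> continuous (fun s : R => 2 * q s * u s).
Proof.
move=> cq cu x; apply: cvgM; last exact: cu.
by apply: cvgM; [exact: cvg_cst|exact: cq].
Qed.

Lemma continuous_volterra {R : realType} (q u : R -> R) :
  continuous q -> continuous u -> continuous (volterra q u).
Proof.
move=> cq cu x; apply: cvgD; first exact: clamp_continuous.
apply: (@continuous_comp _ _ _ (clamp 0 1)); first exact: clamp_continuous.
by do 2 apply: continuous_prim; exact: continuous_volterra_density.
Qed.

(** For the weight with rate l = 4 M + 1, two integrations against a density
bounded by 2 M give the factor 2 M / l ^ 2, which is at most 1 / 2. *)
Lemma volterra_contraction {R : realType} (q u v : R -> R) (M K : R) :
  continuous q -> continuous u -> continuous v -> 0 <= K ->
  (forall x, 0 <= q x <= M) ->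
  (forall x : R, 0 <= x <= 1 -> `|u x - v x| <= K * expR ((4 * M + 1) * x)) ->
  forall x : R, 0 <= x <= 1 ->
  `|volterra q u x - volterra q v x| <= K / 2 * expR ((4 * M + 1) * x).
Proof.
move=> cq cu cv K0 qM uv x x01; set l := 4 * M + 1.
have M0 : 0 <= M by have /andP[] := qM 0; exact: le_trans.
have l0 : 0 < l by rewrite /l; lra.
have H1 := @prim_dist_le_expR R (fun s => 2 * q s * u s) (fun s => 2 * q s * v s) (2 * M * K) l
  (continuous_volterra_density cq cu) (continuous_volterra_density cq cv).
have {}H1 : forall x, 0 <= x <= 1 -> `|prim (fun s => 2 * q s * u s) x -
    prim (fun s => 2 * q s * v s) x| <= 2 * M * K / l * expR (l * x).
  apply: H1 => //; first by rewrite !mulr_ge0.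
  move=> y y01; rewrite -mulrBr normrM -mulrA ler_pM//; last exact: uv.
  by have /andP[q0 qM'] := qM y; rewrite ger0_norm; lra.
have := @prim_dist_le_expR R _ _ (2 * M * K / l) l
  (continuous_prim (continuous_volterra_density cq cu))
  (continuous_prim (continuous_volterra_density cq cv)) _ l0 H1 x x01.
have -> : volterra q u x - volterra q v x =
    prim (prim (fun s => 2 * q s * u s)) x - prim (prim (fun s => 2 * q s * v s)) x.
  by rewrite /volterra clamp_id ?in_itv// opprD addrACA subrr add0r.
move=> /(_ _)/le_trans; apply; first by rewrite divr_ge0 ?mulr_ge0// ltW.
rewrite ler_wpM2r ?expR_ge0//.
rewrite ler_pdivrMr// ler_pdivrMr// /l.
nra.
Qed.

(** With r n the tail 2 C / 2 ^ n of the geometric series, the intervals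
of centre u n and radius r n decrease, and the limit is the supremum of their
left ends. *)
Lemma cvg_halving {R : realType} (u : nat -> R) (C : R) :
  (forall n, `|u n.+1 - u n| <= C / 2 ^+ n) ->
  exists l, forall n, `|u n - l| <= 2 * C / 2 ^+ n.
Proof.
move=> uC.
have C0 : 0 <= C by have := uC 0; rewrite expr0 divr1; exact: le_trans.
pose r n := 2 * C / 2 ^+ n.
have rS n : r n.+1 = r n - C / 2 ^+ n.
  by rewrite /r exprS; field; rewrite expf_neq0.
have inc n k : u n - r n <= u (n + k)%N - r (n + k)%N.
  elim: k => [|k /le_trans]; first by rewrite addn0.
  apply; rewrite addnS rS; have := uC (n + k)%N; rewrite ler_norml; lra.
have dec n k : u (n + k)%N + r (n + k)%N <= u n + r n.
  elim: k => [|k]; first by rewrite addn0.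
  apply: le_trans; rewrite addnS rS; have := uC (n + k)%N; rewrite ler_norml; lra.
have r0 n : 0 <= r n by rewrite /r divr_ge0 ?mulr_ge0 ?exprn_ge0.
have bd n m : u n - r n <= u m + r m.
  apply: le_trans (dec m n); rewrite addnC; apply: le_trans (inc n m) _.
  by have := r0 (n + m)%N; lra.
pose E := range (fun n => u n - r n).
exists (sup E) => n; rewrite ler_distl.
have hE : has_sup E.
  by split; [exists (u 0 - r 0), 0|exists (u 0 + r 0) => _ [m _ <-]].
apply/andP; split; rewrite -/(r n).
- rewrite lerBlDr; apply: ge_sup; first by case: hE.
  by move=> _ [m _ <-]; exact: bd.
- by rewrite -lerBlDr; apply: sup_upper_bound => //; exists n.
Qed.

Lemma halving_le0 {R : realType} (a D : R) :
  (forall n, a <= D / 2 ^+ n) -> a <= 0.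
Proof.
move=> aD; rewrite leNgt; apply/negP => a0.
have := aD (Num.bound (D / a)); apply/negP; rewrite -ltNge.
by rewrite ltr_pdivrMr ?exprn_gt0// mulrC -ltr_pdivrMr// upper_nthrootP.
Qed.

Lemma prim_ge0 {R : realType} (f : R -> R) : continuous f ->
  (forall x, 0 <= x <= 1 -> 0 <= f x) -> forall x, 0 <= x <= 1 -> 0 <= prim f x.
Proof.
move=> cf f0 x /andP[x0 x1]; rewrite -(prim0 f).
apply: ger0_is_derive_le x0 (fun x => is_derive_prim x cf) _ => y /andP[y0 yx].
by apply: f0; rewrite y0 (le_trans yx).
Qed.

Lemma le_expR_growth {R : realType} (l K x : R) : 0 <= l -> 0 <= K ->
  0 <= x <= 1 -> K <= K * expR (l * x) <= K * expR l.
Proof.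
move=> l0 K0 /andP[x0 x1]; rewrite ler_peMr//=; last first.
  by rewrite -expR0 ler_expR mulr_ge0.
by rewrite ler_wpM2l// ler_expR ler_piMr.
Qed.

(** Iterating the contraction on a pair of fixed points halves the bound on their
distance at each step. *)
Lemma volterra_fixpoint_unique {R : realType} (q g h : R -> R) (M : R) :
  continuous q -> continuous g -> continuous h -> (forall x, 0 <= q x <= M) ->
  (forall x, g x = volterra q g x) -> (forall x, h x = volterra q h x) ->
  g =1 h.
Proof.
move=> cq cg ch qM gE hE x.
have M0 : 0 <= M by have /andP[] := qM 0; exact: le_trans.
have l0 : 0 <= 4 * M + 1 by lra.
have cgh : continuous (fun x => g x - h x).
  by move=> y; apply: cvgB; [exact: cg|exact: ch].
have [K K0 HK] := continuous_bounded_itv ler01 (continuous_subspaceT cgh).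
have H n (y : R) : 0 <= y <= 1 -> `|g y - h y| <= K / 2 ^+ n * expR ((4 * M + 1) * y).
  elim: n y => [|n IH] y y01.
    rewrite expr0 divr1; apply: le_trans (HK y _) _; first by rewrite in_itv.
    by have /andP[] := le_expR_growth l0 K0 y01.
  have Kn : 0 <= K / 2 ^+ n by rewrite divr_ge0.
  have := volterra_contraction cq cg ch Kn qM IH y01.
  by rewrite -gE -hE exprSr invfM mulrA.
suff Hc y : 0 <= y <= 1 -> g y = h y.
  have cc := @clamp_itv R 0 1 x ler01; rewrite in_itv/= in cc.
  have := Hc _ cc; rewrite gE hE /volterra (clamp_id (clamp_itv x ler01)) => e.
  by rewrite gE hE.
move=> y01; apply/eqP; rewrite -subr_eq0 -normr_le0.
apply: (@halving_le0 _ _ (K * expR (4 * M + 1))) => n.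
apply: le_trans (H n y y01) _.
have Kn : 0 <= K / 2 ^+ n by rewrite divr_ge0.
by have /andP[_] := le_expR_growth l0 Kn y01; rewrite (mulrAC K (expR _)).
Qed.

(** Picard iteration from the solution t of the case q = 0.  As q is nonnegative
the iterates stay above it, and so does the limit: this keeps psi 1 away from 0,
so that its negative powers make sense. *)
Lemma volterra_fixpoint {R : realType} (q : R -> R) (M : R) :
  continuous q -> (forall x, 0 <= q x <= M) ->
  exists g, [/\ continuous g, forall x, g x = volterra q g x &
    forall x : R, 0 <= x <= 1 -> x <= g x].
Proof.
move=> cq qM.
have M0 : 0 <= M by have /andP[] := qM 0; exact: le_trans.
have l0 : 0 <= 4 * M + 1 by lra.
pose w n := iter n (volterra q) (clamp 0 1).
have cw n : continuous (w n).
  by elim: n => [|n IH]; [exact: clamp_continuous|exact: continuous_volterra].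
have wS n : w n.+1 = volterra q (w n) by [].
have wc n x : w n x = w n (clamp 0 1 x).
  have cx := clamp_id (@clamp_itv R 0 1 x ler01).
  by case: n => [|n]; rewrite ?wS /volterra /w/= cx.
have wge n x : 0 <= x <= 1 -> x <= w n x.
  elim: n x => [|n IH] x x01; first by rewrite /w/= clamp_id.
  rewrite wS /volterra clamp_id// lerDl.
  have cf := continuous_volterra_density cq (cw n).
  apply: prim_ge0 => // [|y y01]; first exact: continuous_prim.
  apply: prim_ge0 => // z z01.
  have /andP[q0 _] := qM z; rewrite mulr_ge0 ?mulr_ge0//.
  by apply: le_trans (IH _ z01); case/andP: z01.
have cd : continuous (fun x => w 1%N x - w 0%N x).
  by move=> y; apply: cvgB; exact: cw.
have [K K0 HK] := continuous_bounded_itv ler01 (continuous_subspaceT cd).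
have H n (y : R) : 0 <= y <= 1 ->
    `|w n.+1 y - w n y| <= K / 2 ^+ n * expR ((4 * M + 1) * y).
  elim: n y => [|n IH] y y01.
    rewrite expr0 divr1; apply: le_trans (HK y _) _; first by rewrite in_itv.
    by have /andP[] := le_expR_growth l0 K0 y01.
  have Kn : 0 <= K / 2 ^+ n by rewrite divr_ge0.
  have := volterra_contraction cq (cw n.+1) (cw n) Kn qM IH y01.
  by rewrite -!wS exprSr invfM mulrA.
pose C := K * expR (4 * M + 1).
have C0 : 0 <= C by rewrite mulr_ge0 ?expR_ge0.
have HC n x : `|w n.+1 x - w n x| <= C / 2 ^+ n.
  have cc := @clamp_itv R 0 1 x ler01; rewrite in_itv/= in cc.
  rewrite (wc n.+1) (wc n); apply: le_trans (H n _ cc) _.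
  have Kn : 0 <= K / 2 ^+ n by rewrite divr_ge0.
  by have /andP[_] := le_expR_growth l0 Kn cc; rewrite (mulrAC K (expR _)).
have /choice[g Hg] : forall x, exists l, forall n, `|w n x - l| <= 2 * C / 2 ^+ n.
  by move=> x; apply: cvg_halving.
have small (e : R) : 0 < e -> exists n, 2 * C / 2 ^+ n < e.
  move=> e0; exists (Num.bound (2 * C / e)).
  by rewrite ltr_pdivrMr ?exprn_gt0// (mulrC e) -ltr_pdivrMr// upper_nthrootP.
have cg : continuous g.
  move=> x; apply/cvgrPdist_lt => e e0.
  have [|n Hn] := small (e / 3); first by rewrite divr_gt0.
  have /cvgrPdist_lt/(_ (e / 3)) := cw n x; rewrite divr_gt0// => /(_ isT).
  apply: filterS => y wxy.
  have := Hg x n; have := Hg y n; move: wxy.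
  rewrite !(ltr_norml, ler_norml); lra.
exists g; split => //.
- move=> x; apply/eqP; rewrite -subr_eq0 -normr_le0.
  apply: (@halving_le0 _ _ (2 * C * (1 + expR (4 * M + 1)))) => n.
  have H1 := Hg x n.+1; have {H1} H1 : `|w n.+1 x - g x| <= 2 * C / 2 ^+ n.
    apply: le_trans H1 _; rewrite ler_wpM2l ?mulr_ge0// lef_pV2 ?posrE ?exprn_gt0//.
    by rewrite ler_weXn2l// ler1n.
  have cc := @clamp_itv R 0 1 x ler01; rewrite in_itv/= in cc.
  have Cn : 0 <= 2 * C / 2 ^+ n by rewrite divr_ge0 ?mulr_ge0.
  have H2 y : 0 <= y <= 1 -> `|w n y - g y| <= 2 * C / 2 ^+ n * expR ((4 * M + 1) * y).
    by move=> y01; apply: le_trans (Hg y n) _; have /andP[] := le_expR_growth l0 Cn y01.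
  have := volterra_contraction cq (cw n) cg Cn qM H2 cc.
  have vc u : volterra q u (clamp 0 1 x) = volterra q u x.
    by rewrite /volterra (clamp_id (clamp_itv x ler01)).
  rewrite !vc -wS => H3.
  have Cn2 : 0 <= 2 * C / 2 ^+ n / 2 by rewrite divr_ge0.
  have /andP[_ H4] := le_expR_growth l0 Cn2 cc.
  have H5 : 2 * C / 2 ^+ n / 2 * expR (4 * M + 1) <= 2 * C / 2 ^+ n * expR (4 * M + 1).
    by rewrite ler_wpM2r ?expR_ge0// ler_pdivrMr// ler_peMr// ler1n.
  rewrite mulrAC mulrDr mulr1.
  apply: le_trans (ler_distD (w n.+1 x) _ _) _; rewrite (distrC (g x)).
  exact: lerD H1 (le_trans H3 (le_trans H4 H5)).
- move=> x x01; rewrite -subr_le0; apply: (@halving_le0 _ _ (2 * C)) => n.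
  by have := Hg x n; have := wge n x x01; rewrite ler_norml; lra.
Qed.

(** * Test functions *)

Lemma exprn_le_expR {R : realType} (n : nat) (y : R) : 0 <= y ->
  y ^+ n.+1 <= n.+1%:R ^+ n.+1 * expR y.
Proof.
move=> y0; have n0 : 0 < n.+1%:R :> R by [].
rewrite -ler_pdivrMl ?exprn_gt0// mulrC -expr_div_n.
have -> : expR y = expR (y / n.+1%:R) ^+ n.+1.
  by rewrite -expRM_natl mulrC divfK// gt_eqF.
rewrite ler_pXn2r ?nnegrE ?expR_ge0 ?divr_ge0//.
by apply: le_trans (expR_ge1Dx _); rewrite lerDr.
Qed.

(** The powers of the inverse are part of the family in order that it be closed
under differentiation, up to linear combinations. *)
Definition flat {R : realType} (k : nat) (x : R) : R :=
  if 0 < x then x ^- k * expR (- x^-1) else 0.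

Lemma flat_ge0 {R : realType} k (x : R) : 0 <= flat k x.
Proof.
by rewrite /flat; case: ifPn => // x0; rewrite mulr_ge0 ?expR_ge0 ?invr_ge0 ?exprn_ge0 ?ltW.
Qed.

(** Exponential decay in 1 / x beats any power of 1 / x; the linear bound is what
continuity at 0 needs. *)
Lemma flat_le {R : realType} k (x : R) :
  flat k x <= k.+1%:R ^+ k.+1 * `|x|.
Proof.
rewrite /flat; case: ifPn => x0; last by rewrite mulr_ge0// exprn_ge0.
rewrite gtr0_norm// expRN ler_pdivrMr ?expR_gt0// mulrAC -ler_pdivrMr//.
have := @exprn_le_expR R k x^-1; rewrite invr_ge0 ltW// => /(_ isT).
by rewrite exprVn exprSr invfM.
Qed.

Lemma flat_continuous0 {R : realType} k : {for 0, continuous (@flat R k)}.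
Proof.
rewrite /prop_for /continuous_at {2}/flat ltxx.
apply/cvgr0Pnorm_le => e e0.
have k0 : 0 < k.+1%:R ^+ k.+1 :> R by rewrite exprn_gt0.
near=> x; rewrite ger0_norm ?flat_ge0//; apply: le_trans (flat_le _ _) _.
rewrite -ler_pdivlMl// mulrC.
near: x; apply: (@cvgr0_norm_le _ _ _ _ _ id); last by rewrite divr_gt0.
exact: cvg_id.
Unshelve. all: by end_near. Qed.

(** The point 0 is the only delicate one: there the difference quotient of
[flat k] is [flat k.+1], which tends to 0. *)
Lemma is_derive_flat {R : realType} k (x : R) :
  is_derive x 1 (flat k) (flat k.+2 x - k%:R * flat k.+1 x).
Proof.
have [x0|x0|->] := ltgtP x 0.
- rewrite /flat ltNge (ltW x0) mulr0 subrr.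
  apply: (@near_eq_is_derive _ _ _ (cst 0)).
  by near=> y; rewrite ifN// -leNgt; apply: ltW; near: y; apply: lt_nbhsl.
- have E : is_derive x 1 (fun y : R => y ^- k * expR (- y^-1))
     (flat k.+2 x - k%:R * flat k.+1 x).
    have xn0 : x != 0 by rewrite gt_eqF.
    have dV : is_derive x 1 (fun y : R => y^-1) (- x ^- 2).
      by have := @is_deriveV R id x 1 1 xn0 _; rewrite /GRing.scale/= mulr1; apply.
    have dX (u : R) : is_derive u 1 (fun u : R => u ^+ k) (k%:R * u ^+ k.-1).
      apply: DeriveDef; first exact: exprn_derivable.
      by rewrite -derive1E exp_derive1.
    have dE (u : R) : is_derive u 1 (fun u : R => expR (- u)) (- expR (- u)).
      have := is_derive_expRM (-1) u; rewrite !mulN1r.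
      by under eq_fun do rewrite mulN1r.
    have := @is_derive1_comp _ (fun u => u ^+ k * expR (- u)) _ x _ _ _ dV.
    move=> /(_ _ (is_deriveM (dX x^-1) (dE x^-1))).
    rewrite /comp/=; under eq_fun do rewrite exprVn.
    move=> H; apply: is_derive_eq H _.
    rewrite /GRing.scale/= /flat x0 !exprS !invfM.
    case: k {dX} => [|k]; first by rewrite expr0; ring.
    by rewrite succnK -!exprVn expr0 !exprS; ring.
  apply: near_eq_is_derive E; near=> y; rewrite /flat ifT//.
  by near: y; apply: lt_nbhsr.
- apply/is_derive1_caratheodory; exists (flat k.+1); split.
  + move=> z; rewrite {2}/flat ltxx !subr0 /flat; case: ifPn => z0; last by rewrite mul0r.
    by rewrite exprSr invfM -mulrA (mulrC _ z) mulrA -(mulrA _ _ z) mulVf ?gt_eqF// mulr1.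
  + exact: flat_continuous0.
  + by rewrite /flat ltxx mulr0 subrr.
Unshelve. all: by end_near. Qed.

(** A class of functions stable under differentiation, whose members are therefore
smooth: no derivative of higher order has to be computed. *)
Inductive bumpy {R : realType} : (R -> R) -> Prop :=
| bumpy_flat k (a b : R) : bumpy (fun x => flat k (a * x + b))
| bumpy_add f g : bumpy f -> bumpy g -> bumpy (fun x => f x + g x)
| bumpy_mul f g : bumpy f -> bumpy g -> bumpy (fun x => f x * g x)
| bumpy_scale (c : R) f : bumpy f -> bumpy (fun x => c * f x).

Lemma bumpy_derive {R : realType} (f : R -> R) : bumpy f ->
  exists2 f', bumpy f' & forall x : R, is_derive x 1 f (f' x).
Proof.
elim=> {f} [k a b|f g _ [f' bf' df] _ [g' bg' dg]|f g bf [f' bf' df] bg [g' bg' dg]|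
    c f _ [f' bf' df]].
- exists (fun x => a * (flat k.+2 (a * x + b) + (- k%:R) * flat k.+1 (a * x + b))).
    apply: bumpy_scale; apply: bumpy_add; first exact: bumpy_flat.
    by apply: bumpy_scale; exact: bumpy_flat.
  move=> x; have := @is_derive1_comp _ (flat k) _ x _ _
    (is_derive_flat k _) (is_derive_affine a b x).
  by rewrite mulNr mulrC.
- exists (fun x => f' x + g' x); first exact: bumpy_add.
  by move=> x; exact: is_deriveD.
- exists (fun x => f x * g' x + g x * f' x).
    by apply: bumpy_add; apply: bumpy_mul.
  by move=> x; exact: is_deriveM.
- exists (fun x => c * f' x); first exact: bumpy_scale.
  by move=> x; exact: is_deriveZ.
Qed.

Lemma bumpy_smooth {R : realType} (f : R -> R) : bumpy f ->
  forall n x, derivable (derive1n n f) x 1.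
Proof.
move=> bf n; elim: n f bf => [|n IH] f /bumpy_derive[f' bf' df] x.
  by have [] := df x.
by rewrite derive1Sn (derive1_is_derive df); exact: IH.
Qed.

(** The product of a factor vanishing on the left of - e and one vanishing on the
right of e; both arguments are kept in the affine shape of [bumpy_flat]. *)
Definition bump {R : realType} (e x : R) : R :=
  flat 0 (1 * x + e) * flat 0 (- 1 * x + e).

Lemma bumpy_bump {R : realType} (e : R) : bumpy (bump e).
Proof. by apply: bumpy_mul; exact: bumpy_flat. Qed.

Lemma bump_ge0 {R : realType} (e x : R) : 0 <= bump e x.
Proof. by rewrite mulr_ge0// flat_ge0. Qed.

Lemma bump_gt0 {R : realType} (e x : R) : `|x| < e -> 0 < bump e x.
Proof.
rewrite ltr_norml => /andP[xe ex].
by rewrite /bump /flat !ifT ?expr0 ?invr1 ?mul1r ?mulr_gt0 ?expR_gt0//; lra.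
Qed.

Lemma bump_eq0 {R : realType} (e x : R) : e <= `|x| -> bump e x = 0.
Proof.
rewrite ler_normr => /orP[] h; rewrite /bump /flat.
  by rewrite [X in _ * X]ifN ?mulr0// -leNgt; lra.
by rewrite [X in X * _]ifN ?mul0r// -leNgt; lra.
Qed.

Lemma bumpy_continuous {R : realType} (f : R -> R) : bumpy f -> continuous f.
Proof. by move=> /bumpy_derive[f' _]; exact: is_derive_continuous. Qed.

Definition bump_prim {R : realType} (e x : R) : R :=
  prim (bump e) x - prim (bump e) (- e).

(** A second primitive of [bump e], zero on the left of - e and affine on the right
of e: a smoothed version of the positive part. *)
Definition bump_prim2 {R : realType} (e x : R) : R :=
  prim (bump_prim e) x - prim (bump_prim e) (- e).

Lemma is_derive_bump_prim {R : realType} (e x : R) :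
  is_derive x 1 (bump_prim e) (bump e x).
Proof.
rewrite -[bump e x]subr0; apply: is_deriveB.
by apply: is_derive_prim; apply: bumpy_continuous; exact: bumpy_bump.
Qed.

Lemma is_derive_bump_prim2 {R : realType} (e x : R) :
  is_derive x 1 (bump_prim2 e) (bump_prim e x).
Proof.
rewrite -[bump_prim e x]subr0; apply: is_deriveB.
apply: is_derive_prim; apply: is_derive_continuous => ?; exact: is_derive_bump_prim.
Qed.

Lemma bump_prim_dist_le_expRft {R : realType} (e x : R) : x <= - e -> bump_prim e x = 0.
Proof.
move=> xe; rewrite -(is_derive_0_eq xe (is_derive_bump_prim e)).
  by rewrite /bump_prim subrr.
by move=> y /andP[xy ye]; rewrite bump_eq0// ler_normr; apply/orP; right; lra.
Qed.

Lemma bump_prim_right {R : realType} (e x : R) : e <= x ->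
  bump_prim e x = bump_prim e e.
Proof.
move=> ex; apply: is_derive_0_eq ex (is_derive_bump_prim e) _.
by move=> y /andP[ey yx]; rewrite bump_eq0// ler_normr ey.
Qed.

Lemma bump_prim_gt0 {R : realType} (e : R) : 0 < e -> 0 < bump_prim e e.
Proof.
move=> e0; rewrite -(@bump_prim_dist_le_expRft _ e (- e))// -subr_gt0.
have ee : - e < e by lra.
have [||c] := @MVT _ (bump_prim e) (bump e) (- e) e ee.
- by move=> x _; exact: is_derive_bump_prim.
- apply: continuous_subspaceT; apply: is_derive_continuous.
  exact: is_derive_bump_prim.
rewrite in_itv/= => /andP[ec ce] ->.
by rewrite mulr_gt0 ?subr_gt0// bump_gt0// ltr_norml ec.
Qed.

Lemma bump_prim2_left {R : realType} (e x : R) : x <= - e -> bump_prim2 e x = 0.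
Proof.
move=> xe; rewrite -(is_derive_0_eq xe (is_derive_bump_prim2 e)).
  by rewrite /bump_prim2 subrr.
by move=> y /andP[xy ye]; exact: bump_prim_dist_le_expRft.
Qed.

Lemma bump_prim2_right {R : realType} (e x : R) : e <= x ->
  bump_prim2 e x = bump_prim2 e e + bump_prim e e * (x - e).
Proof.
move=> ex.
have d (y : R) : is_derive y 1 (fun y => bump_prim2 e y - bump_prim e e * (y - e))
    (bump_prim e y - bump_prim e e).
  apply: is_deriveB; first exact: is_derive_bump_prim2.
  have := is_derive_affine (bump_prim e e) (- (bump_prim e e * e)) y.
  by under eq_fun do rewrite -mulrBr.
have := is_derive_0_eq ex d; rewrite subrr mulr0 subr0 => <-; first by rewrite subrK.
by move=> y /andP[ey _]; rewrite (bump_prim_right ey) subrr.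
Qed.

(** The coefficients are those of the second difference at a, b, c, which kills
affine functions.  As [bump_prim2] is affine far to the right, the combination
has compact support although its three terms have not. *)
Definition test3 {R : realType} (e a b c x : R) : R :=
  (c - b) * bump_prim2 e (x - a) + (- (c - a)) * bump_prim2 e (x - b) +
  (b - a) * bump_prim2 e (x - c).

Definition test3'' {R : realType} (e a b c x : R) : R :=
  (c - b) * bump e (x - a) + (- (c - a)) * bump e (x - b) +
  (b - a) * bump e (x - c).

Lemma comb3_is_derive {R : realType} (F f : R -> R) (u v w a b c : R) :
  (forall x : R, is_derive x 1 F (f x)) -> forall x : R,
  is_derive x 1 (fun x => u * F (x - a) + v * F (x - b) + w * F (x - c))
    (u * f (x - a) + v * f (x - b) + w * f (x - c)).
Proof.
by move=> dF x; apply: is_deriveD; [apply: is_deriveD|];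
  apply: is_deriveZ; exact: is_derive_shift_arg.
Qed.

Lemma derive2_test3 {R : realType} (e a b c : R) :
  derive1n 2 (test3 e a b c) = test3'' e a b c.
Proof.
rewrite derive1Sn (derive1_is_derive (comb3_is_derive _ _ _ a b c (is_derive_bump_prim2 e))).
rewrite derive1n1.
exact: (derive1_is_derive (comb3_is_derive _ _ _ a b c (is_derive_bump_prim e))).
Qed.

Lemma bumpy_bump_shift {R : realType} (e u : R) : bumpy (fun x => bump e (x - u)).
Proof.
rewrite /bump; apply: bumpy_mul.
  have -> : (fun x => flat 0 (1 * (x - u) + e)) = (fun x => flat 0 (1 * x + (e - u))).
    by apply/funext => x; congr flat; ring.
  exact: bumpy_flat.
have -> : (fun x => flat 0 (- 1 * (x - u) + e)) = (fun x => flat 0 (- 1 * x + (e + u))).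
  by apply/funext => x; congr flat; ring.
exact: bumpy_flat.
Qed.

Lemma bumpy_test3'' {R : realType} (e a b c : R) : bumpy (test3'' e a b c).
Proof.
by apply: bumpy_add; [apply: bumpy_add|]; apply: bumpy_scale; exact: bumpy_bump_shift.
Qed.

Lemma test3_test_function {R : realType} (e a b c : R) :
  0 < e -> 0 < a - e -> a <= b -> b <= c -> c + e < 1 ->
  test_function 0 1 (test3 e a b c).
Proof.
move=> e0 ae ab bc ce.
have sub : closure [set x | test3 e a b c x != 0] `<=` `[a - e, c + e].
  have cl : closed `[a - e, c + e]%classic by exact: interval_closed.
  rewrite [X in _ `<=` X](closure_id _).1//.
  apply: closure_subset => x /= ; apply: contraNP => /negP.
  rewrite in_itv/= negb_and -!ltNge => /orP[]xx; rewrite /test3.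
    by rewrite !bump_prim2_left ?mulr0 ?addr0//; lra.
  rewrite (@bump_prim2_right _ e (x - a)); last lra.
  rewrite (@bump_prim2_right _ e (x - b)); last lra.
  rewrite (@bump_prim2_right _ e (x - c)); last lra.
  by move: (bump_prim2 e e) (bump_prim e e) => A B; apply/eqP; ring.
split.
- case=> [|[|n]] x.
  + by have [] := comb3_is_derive (c - b) (- (c - a)) (b - a) a b c (is_derive_bump_prim2 e) x.
  + rewrite derive1n1 (derive1_is_derive (comb3_is_derive _ _ _ a b c (is_derive_bump_prim2 e))).
    by have [] := comb3_is_derive (c - b) (- (c - a)) (b - a) a b c (is_derive_bump_prim e) x.
  + rewrite (_ : derive1n n.+2 _ = derive1n n (derive1n 2 (test3 e a b c))); last first.
      by rewrite !derive1Sn.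
    by rewrite derive2_test3; apply: bumpy_smooth; exact: bumpy_test3''.
- apply: subclosed_compact sub; [exact: closed_closure|exact: segment_compact].
- apply: subset_trans sub _; apply: subset_itvSoo; rewrite bnd_simp; lra.
Qed.

(** Integration against a narrow bump at a evaluates v at a, up to the mass of the
bump and the oscillation of v. *)
Lemma localized_integral {R : realType} (v : R -> R) (e a d : R) :
  continuous v -> 0 < e -> 0 <= a - e -> a + e <= 1 ->
  (forall x, `|x - a| < e -> `|v x - v a| <= d) ->
  `|prim (fun x => v x * bump e (x - a)) 1 - v a * bump_prim e e| <= d * bump_prim e e.
Proof.
move=> cv e0 ae ea vd.
have dH := is_derive_shift_arg a (is_derive_bump_prim e).
have cb := bumpy_continuous (bumpy_bump_shift e a).
have cvb : continuous (fun x : R => v x * bump e (x - a)).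
  by move=> x; apply: cvgM; [exact: cv|exact: cb].
have dV (x : R) := is_derive_prim x cvb.
have dG k (x : R) : is_derive x 1 (fun x => k * bump_prim e (x - a)) (k * bump e (x - a)).
  by apply: is_deriveZ; exact: dH.
have vle x : `|v x * bump e (x - a) - v a * bump e (x - a)| <= d * bump e (x - a).
  rewrite -mulrBl normrM (ger0_norm (bump_ge0 _ _)).
  have [xa|xa] := ltP `|x - a| e; first by rewrite ler_wpM2r ?bump_ge0 ?vd.
  by rewrite bump_eq0// !mulr0.
have Ha1 : bump_prim e (1 - a) = bump_prim e e by apply: bump_prim_right; lra.
have Ha0 : bump_prim e (0 - a) = 0 by apply: bump_prim_dist_le_expRft; lra.
have := is_derive_le ler01 dV (dG (v a + d)).
have := is_derive_le ler01 (dG (v a - d)) dV.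
rewrite Ha1 Ha0 prim0 !mulr0 !subr0 => H1 H2.
have {}H1 : (v a - d) * bump_prim e e <= prim (fun x => v x * bump e (x - a)) 1.
  by apply: H1 => x _; have := vle x; rewrite ler_norml; lra.
have {}H2 : prim (fun x => v x * bump e (x - a)) 1 <= (v a + d) * bump_prim e e.
  by apply: H2 => x _; have := vle x; rewrite ler_norml; lra.
move: H1 H2; move: (prim _ _) (bump_prim e e) => A B H1 H2.
rewrite ler_norml; lra.
Qed.

(** Testing against [test3] and letting e tend to 0 isolates the second difference
of v at a, b, c: a weak second derivative that vanishes forces v to be affine. *)
Lemma affine_of_test {R : realType} (v : R -> R) : continuous v ->
  (forall phi, test_function 0 1 phi ->
    \int[@lebesgue_measure R]_(t in `]0, 1[) (v t * derive1n 2 phi t) = 0) ->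
  forall a b c : R, 0 < a -> a < b -> b < c -> c < 1 ->
  (c - b) * v a - (c - a) * v b + (b - a) * v c = 0.
Proof.
move=> cv vphi a b c a0 ab bc c1; apply/eqP; rewrite -normr_le0.
apply/ler_addgt0Pr => d d0; rewrite add0r.
have d4 : 0 < d / 4 by rewrite divr_gt0.
have [r r0 Hr] := unif_continuous_itv 0 1 cv d4.
pose e := Num.min r (Num.min a (1 - c) / 2).
have e0 : 0 < e by rewrite lt_min r0 divr_gt0// lt_min a0 subr_gt0.
have er : e <= r by rewrite ge_min lexx.
have ea : e <= a / 2.
  by rewrite ge_min; apply/orP; right; rewrite ler_pM2r// ge_min lexx.
have ec : e <= (1 - c) / 2.
  by rewrite ge_min; apply/orP; right; rewrite ler_pM2r// ge_min lexx orbT.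
have L u : a <= u <= c ->
    `|prim (fun x => v x * bump e (x - u)) 1 - v u * bump_prim e e| <= d / 4 * bump_prim e e.
  move=> /andP[au uc]; apply: localized_integral => //; [lra|lra|].
  move=> x xu; rewrite distrC; apply: Hr; first by rewrite in_itv/=; lra.
  by rewrite distrC; exact: lt_le_trans er.
have := vphi (test3 e a b c) (test3_test_function e0 _ (ltW ab) (ltW bc) _).
rewrite derive2_test3 => /(_ _ _)H.
have {H} : \int[@lebesgue_measure R]_(t in `]0, 1[) (v t * test3'' e a b c t) = 0.
  by apply: H; lra.
have cu u : continuous (fun x : R => v x * bump e (x - u)).
  move=> x; apply: cvgM; first exact: cv.
  exact: (bumpy_continuous (bumpy_bump_shift e u)).
have cc : continuous (fun x : R => v x * test3'' e a b c x).
  move=> x; apply: cvgM; first exact: cv.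
  exact: (bumpy_continuous (bumpy_test3'' e a b c)).
have dF (x : R) : is_derive x 1 (fun x => (c - b) * prim (fun x => v x * bump e (x - a)) x +
    (- (c - a)) * prim (fun x => v x * bump e (x - b)) x +
    (b - a) * prim (fun x => v x * bump e (x - c)) x) (v x * test3'' e a b c x).
  rewrite /test3'' 2!mulrDr (mulrCA _ (c - b)) (mulrCA _ (- (c - a))) (mulrCA _ (b - a)).
  by apply: is_deriveD; [apply: is_deriveD|]; apply: is_deriveZ; exact: is_derive_prim.
rewrite Rintegral_itv_obnd_cbnd; last exact: continuous_integrable.
rewrite Rintegral_itv_bndo_bndc; last exact: continuous_integrable.
rewrite (Rintegral_is_derive ler01 cc dF) !prim0 !mulr0 !addr0 subr0.
have := L a; have := L b; have := L c.
rewrite !lexx (ltW ab) (ltW bc) (ltW (lt_trans ab bc)).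
move=> /(_ isT) Lc /(_ isT) Lb /(_ isT) La.
have N0 := bump_prim_gt0 e0.
rewrite -(ler_pM2r N0) -(gtr0_norm N0) -normrM (gtr0_norm N0).
move: La Lb Lc N0; clear -ab bc d0 a0 c1.
move: (bump_prim e e) (prim _ 1) (prim _ 1) (prim _ 1) => N A B C.
clear e; move: (v a) (v b) (v c) => va vb vc Ha Hb Hc N0 E.
have -> : ((c - b) * va - (c - a) * vb + (b - a) * vc) * N =
    ((c - b) * C + - (c - a) * B + (b - a) * A) -
    ((c - b) * (C - va * N) - (c - a) * (B - vb * N) + (b - a) * (A - vc * N)) by ring.
rewrite E sub0r normrN; move: Ha Hb Hc.
move: (C - _) (B - _) (A - _) => X Y Z HX HY HZ.
apply: le_trans (ler_normD _ _) _.
apply: le_trans (lerD (ler_normB _ _) (lexx _)) _.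
have cb : 0 < c - b by lra.
have ca : 0 < c - a by lra.
have ba : 0 < b - a by lra.
rewrite !normrM (gtr0_norm cb) (gtr0_norm ca) (gtr0_norm ba).
have dN : 0 <= d / 4 * N by rewrite mulr_ge0 ?divr_ge0 ?ltW.
move: HX HY HZ dN; move: `|X| `|Y| `|Z| => x y z HX HY HZ dN.
have -> : d * N = d / 4 * N * 4 by field.
move: HX HY HZ dN; move: (d / 4 * N) => k HX HY HZ dN.
have H1 : (c - b) * x <= (c - b) * k by rewrite ler_wpM2l// subr_ge0 ltW.
have H2 : (c - a) * y <= (c - a) * k by rewrite ler_wpM2l// subr_ge0 ltW// (lt_trans ab).
have H3 : (b - a) * z <= (b - a) * k by rewrite ler_wpM2l// subr_ge0 ltW.
nra.
Qed.

(** * The equation in the sense of distributions *)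

Lemma continuous_zero_ends {R : realType} (k : R -> R) (a b : R) : a < b ->
  continuous k -> (forall t, a < t < b -> k t = 0) -> k a = 0 /\ k b = 0.
Proof.
move=> ab ck k0; split; apply/eqP/negPn/negP => ka0.
- have ka : 0 < `|k a| by rewrite normr_gt0.
  have /cvgrPdist_lt/(_ _ ka)[r /= r0 kr] := ck a.
  pose m := Num.min r (b - a) / 2.
  have m0 : 0 < m by rewrite divr_gt0// lt_min r0 subr_gt0.
  have mr : m <= r / 2 by rewrite ler_pM2r// ge_min lexx.
  have mb : m <= (b - a) / 2 by rewrite ler_pM2r// ge_min lexx orbT.
  have : ball_ [eta Num.Def.normr] a r (a + m).
    by rewrite /= opprD addNKr normrN gtr0_norm//; lra.
  by move=> /kr /=; rewrite (k0 (a + m)) ?subr0 ?ltxx//; lra.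
- have ka : 0 < `|k b| by rewrite normr_gt0.
  have /cvgrPdist_lt/(_ _ ka)[r /= r0 kr] := ck b.
  pose m := Num.min r (b - a) / 2.
  have m0 : 0 < m by rewrite divr_gt0// lt_min r0 subr_gt0.
  have mr : m <= r / 2 by rewrite ler_pM2r// ge_min lexx.
  have mb : m <= (b - a) / 2 by rewrite ler_pM2r// ge_min lexx orbT.
  have : ball_ [eta Num.Def.normr] b r (b - m).
    by rewrite /= opprB addrC subrK gtr0_norm//; lra.
  by move=> /kr /=; rewrite (k0 (b - m)) ?subr0 ?ltxx//; lra.
Qed.

Lemma test_function_ends {R : realType} (phi : R -> R) (x : R) :
  test_function 0 1 phi -> (x = 0 \/ x = 1) ->
  phi x = 0 /\ derive1 phi x = 0.
Proof.
move=> [sm _ sub] xx.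
have nx : ~ closure [set x | phi x != 0] x.
  by move=> /sub /=; rewrite in_itv/=; case: xx => ->; rewrite ltxx ?andbF.
have near0 : \near x, phi x = cst 0 x.
  have /open_nbhs_nbhs : open_nbhs x (~` closure [set x | phi x != 0]).
    by split => //; apply: closed_openC; exact: closed_closure.
  apply: filterS => y /= ny; apply/eqP/negPn/negP => y0; apply: ny.
  exact: subset_closure.
split; first exact: (nbhs_singleton near0).
by rewrite derive1E (near_eq_derive _ near0) derive_cst.
Qed.

(** G phi'' - phi G'' is the derivative of G phi' - phi G', which vanishes at both
ends because phi and phi' do. *)
Lemma weak_second_derivative {R : realType} (G G' h phi : R -> R) :
  (forall x : R, is_derive x 1 G (G' x)) -> (forall x : R, is_derive x 1 G' (h x)) ->
  continuous h -> test_function 0 1 phi ->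
  \int[@lebesgue_measure R]_(t in `]0, 1[) (G t * derive1n 2 phi t) =
  \int[@lebesgue_measure R]_(t in `]0, 1[) (phi t * h t).
Proof.
move=> dG dG' ch tphi; have [sm _ _] := tphi.
have d0 (x : R) : is_derive x 1 phi (derive1 phi x).
  by rewrite derive1E; apply: derivableP; exact: (sm 0%N).
have d1 (x : R) : is_derive x 1 (derive1 phi) (derive1n 2 phi x).
  by rewrite derive1nS derive1n1 derive1E; apply: derivableP; exact: (sm 1%N).
have d2 (x : R) : is_derive x 1 (derive1n 2 phi) (derive1n 3 phi x).
  by rewrite [derive1n 3 phi]derive1nS derive1E; apply: derivableP; exact: (sm 2%N).
have cG := is_derive_continuous dG.
have cp := is_derive_continuous d0; have cp2 := is_derive_continuous d2.
have c1 : continuous (fun t : R => G t * derive1n 2 phi t).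
  by move=> x; apply: cvgM; [exact: cG|exact: cp2].
have c2 : continuous (fun t : R => phi t * h t).
  by move=> x; apply: cvgM; [exact: cp|exact: ch].
have cB : continuous (fun t : R => G t * derive1n 2 phi t - phi t * h t).
  by move=> x; apply: cvgB; [exact: c1|exact: c2].
apply/eqP; rewrite -subr_eq0; apply/eqP.
rewrite -RintegralB//; [|exact: continuous_integrable..].
rewrite Rintegral_itv_obnd_cbnd; last exact: continuous_integrable.
rewrite Rintegral_itv_bndo_bndc; last exact: continuous_integrable.
have dF (x : R) : is_derive x 1 (fun x => G x * derive1 phi x - phi x * G' x)
    (G x * derive1n 2 phi x - phi x * h x).
  have -> : G x * derive1n 2 phi x - phi x * h x =
      (G x *: derive1n 2 phi x + derive1 phi x *: G' x) -
      (phi x *: h x + G' x *: derive1 phi x) by rewrite /GRing.scale/=; ring.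
  exact: is_deriveB (is_deriveM (dG x) (d1 x)) (is_deriveM (d0 x) (dG' x)).
rewrite (Rintegral_is_derive ler01 cB dF).
have [-> ->] := test_function_ends tphi (or_introl erefl).
have [-> ->] := test_function_ends tphi (or_intror erefl).
by rewrite !mul0r !mulr0 !subrr.
Qed.

Lemma is_derive_right_quotient {R : realType} (F : R -> R) (a : R) :
  F 0 = 0 -> is_derive (0 : R) 1 F a -> F t / t @[t --> 0^'+] --> a.
Proof.
move=> F0 /is_derive1_caratheodory[g [Fg cg <-]].
have : g t @[t --> 0^'+] --> g 0 by apply: cvg_at_right_filter; exact: cg.
apply: cvg_trans; apply: near_eq_cvg; near=> t.
have := Fg t; rewrite F0 !subr0 => ->; rewrite mulfK// gt_eqF//.
Unshelve. all: by end_near. Qed.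

Section solves_ode_volterra.
Context {R : realType} (mu : {measure set (measurableTypeR R) -> \bar R}).
Variables (q : R -> R).
Hypothesis cq : continuous q.
Hypothesis muq : forall f : R -> R, continuous f ->
  \int[mu]_(t in `]0, 1[) f t = \int[@lebesgue_measure R]_(t in `]0, 1[) (f t * q t).

Lemma test_function_continuous (phi : R -> R) (a b : R) :
  test_function a b phi -> continuous phi /\ continuous (derive1n 2 phi).
Proof.
move=> [sm _ _]; split.
  have d0 (x : R) : is_derive x 1 phi (derive1 phi x).
    by rewrite derive1E; apply: derivableP; exact: (sm 0%N).
  exact: is_derive_continuous d0.
have d2 (x : R) : is_derive x 1 (derive1n 2 phi) (derive1n 3 phi x).
  by rewrite [derive1n 3 phi]derive1nS derive1E; apply: derivableP; exact: (sm 2%N).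
exact: is_derive_continuous d2.
Qed.

Lemma solves_ode_of_volterra (g : R -> R) : continuous g ->
  (forall x, g x = volterra q g x) -> solves_ode mu g.
Proof.
move=> cg gE; have ch := continuous_volterra_density cq cg.
pose h (s : R) := 2 * q s * g s.
have dG (x : R) : is_derive x 1 (fun x => x + prim (prim h) x) (1 + prim h x).
  by apply: is_deriveD; apply: is_derive_prim; exact: continuous_prim.
have dG' (x : R) : is_derive x 1 (fun x => 1 + prim h x) (h x).
  rewrite -[h x]add0r; apply: is_deriveD; exact: is_derive_prim.
(* The unclamped right-hand side is differentiable on the whole line. *)
have gG x : 0 <= x <= 1 -> g x = x + prim (prim h) x.
  by move=> x01; rewrite gE /volterra clamp_id.
have g0 : g 0 = 0 by rewrite gG ?lexx ?ler01// prim0 addr0.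
split => //.
- exact: continuous_subspaceT.
- have := @is_derive_right_quotient _ (fun x => x + prim (prim h) x) (1 + prim h 0) _ (dG 0).
  rewrite !prim0 !addr0 => /(_ erefl); apply: cvg_trans; apply: near_eq_cvg.
  near=> t; rewrite g0 subr0 gG//; apply/andP; split => //.
  by near: t; exact: nbhs_right_le.
- move=> phi tphi.
  have [cphi _] := test_function_continuous tphi.
  rewrite muq; last first.
    by move=> x; apply: cvgM; [exact: cphi|apply: cvgM; [exact: cvg_cst|exact: cg]].
  rewrite [LHS](_ : _ = \int[lebesgue_measure]_(t in `]0, 1[)
      ((t + prim (prim h) t) * derive1n 2 phi t)); last first.
    apply: eq_Rintegral => x; rewrite inE/= in_itv/= => /andP[x0 x1].
    by rewrite gG// !ltW.
  rewrite (weak_second_derivative dG dG' ch tphi).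
  by apply: eq_Rintegral => x _; rewrite /h; ring.
Unshelve. all: by end_near. Qed.

(** Subtracting from psi the double primitive of 2 q psi leaves a function v with
zero weak second derivative, hence affine on ]0, 1[; the value of psi at 0 and
its right slope there say that v is the identity. *)
Lemma volterra_of_solves_ode (psi : R -> R) : solves_ode mu psi ->
  continuous (psi \o clamp 0 1) /\
  forall x, (psi \o clamp 0 1) x = volterra q (psi \o clamp 0 1) x.
Proof.
move=> [cpsi psi0 dpsi wpsi].
have cg := continuous_clamp ler01 cpsi; split => //.
set g := psi \o clamp 0 1 in cg *.
have ch := continuous_volterra_density cq cg.
pose h (s : R) := 2 * q s * g s.
have gE x : 0 <= x <= 1 -> g x = psi x by move=> x01; rewrite /g/= clamp_id.
have dG (x : R) : is_derive x 1 (prim (prim h)) (prim h x).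
  by apply: is_derive_prim; exact: continuous_prim.
have dG' (x : R) : is_derive x 1 (prim h) (h x) by exact: is_derive_prim.
have cG := is_derive_continuous dG.
pose v (x : R) := g x - prim (prim h) x.
have cv : continuous v by move=> x; apply: cvgB; [exact: cg|exact: cG].
have v0 : v 0 = 0 by rewrite /v prim0 gE ?lexx ?ler01// psi0 subr0.
have weakv phi : test_function 0 1 phi ->
    \int[@lebesgue_measure R]_(t in `]0, 1[) (v t * derive1n 2 phi t) = 0.
  move=> tphi; have [cphi cphi2] := test_function_continuous tphi.
  under eq_Rintegral do rewrite mulrBl.
  rewrite RintegralB//; last 2 first.
  - apply: continuous_integrable => x.
    by apply: cvgM; [exact: cg|exact: cphi2].
  - apply: continuous_integrable => x.
    by apply: cvgM; [exact: cG|exact: cphi2].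
  rewrite (weak_second_derivative dG dG' ch tphi).
  apply/eqP; rewrite subr_eq0; apply/eqP.
  have := wpsi phi tphi.
  rewrite [LHS](_ : _ = \int[@lebesgue_measure R]_(t in `]0, 1[)
      (g t * derive1n 2 phi t)); last first.
    apply: eq_Rintegral => x; rewrite inE/= in_itv/= => /andP[x0 x1].
    by rewrite gE// !ltW.
  move=> ->.
  rewrite [LHS](_ : _ = \int[mu]_(t in `]0, 1[) (phi t * (2 * g t))); last first.
    apply: eq_Rintegral => x; rewrite inE/= in_itv/= => /andP[x0 x1].
    by rewrite gE// !ltW.
  rewrite muq; last first.
    by move=> x; apply: cvgM; [exact: cphi|apply: cvgM; [exact: cvg_cst|exact: cg]].
  by apply: eq_Rintegral => x _; rewrite /h; ring.
have aff := affine_of_test cv weakv.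
(* The second difference at a, b, c is continuous in a: let a tend to 0, where v is 0. *)
have lin b c : 0 < b -> b < c -> c < 1 -> c * v b = b * v c.
  move=> b0 bc c1.
  have [|t /andP[t0 tb]|+ _] := @continuous_zero_ends _
     (fun a => (c - b) * v a - (c - a) * v b + (b - a) * v c) 0 b b0.
  - move=> x; apply: cvgD; [apply: cvgB|]; apply: cvgM;
      by [exact: cvg_cst|exact: cv|apply: cvgB; [exact: cvg_cst|exact: cvg_id]].
  - exact: aff.
  - by rewrite v0 !subr0 mulr0 sub0r addrC => /eqP; rewrite subr_eq0 => /eqP ->.
(* So v t / t is constant, and its value is the right derivative of v at 0. *)
have slope b : 0 < b < 1 -> v b = b.
  move=> /andP[b0 b1].
  have H1 : v t / t @[t --> 0^'+] --> (1 : R).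
    have := is_derive_right_quotient (prim0 _) (dG 0); rewrite prim0 => H0.
    have K : (psi t - psi 0) / t - prim (prim h) t / t @[t --> 0^'+] --> (1 - 0 : R).
      exact: cvgB.
    rewrite subr0 in K; apply: cvg_trans K; apply: near_eq_cvg.
    near=> t; rewrite psi0 subr0 -mulrBl /v gE//.
    by apply/andP; split => //; near: t; exact: nbhs_right_le.
  have H2 : v t / t @[t --> 0^'+] --> v b / b.
    apply: (@cvg_trans _ ((fun=> v b / b) @ 0^'+)); last exact: cvg_cst.
    apply: near_eq_cvg; near=> t; have t0 : 0 < t by [].
    apply/eqP; rewrite eqr_div ?lt0r_neq0//.
    rewrite (mulrC (v b)) (mulrC (v t)) (lin t b)//.
  have E : v b / b = 1 by rewrite -(cvg_lim _ H1)// (cvg_lim _ H2).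
  by rewrite -[LHS](divfK (lt0r_neq0 b0)) E mul1r.
have slope1 b : 0 <= b <= 1 -> v b = b.
  have [||H0 H1] := @continuous_zero_ends _ (fun t => v t - t) 0 1 ltr01.
  - by move=> x; apply: cvgB; [exact: cv|exact: cvg_id].
  - by move=> t t01; rewrite slope// subrr.
  move=> /andP[b0 b1]; have [->|bn0] := eqVneq b 0; first by rewrite v0.
  have [->|bn1] := eqVneq b 1; first by apply/eqP; rewrite -subr_eq0 H1.
  by rewrite slope// !lt_neqAle eq_sym bn0 b0 bn1 b1.
move=> x; rewrite /volterra -[LHS](subrK (prim (prim h) (clamp 0 1 x))).
congr (_ + _); rewrite -[RHS]slope1; last exact: (clamp_itv x ler01).
by rewrite /v /g/= (clamp_id (clamp_itv x ler01)).
Unshelve. all: by end_near. Qed.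

End solves_ode_volterra.

(** * The Euler scheme *)

(** The position is updated with the old slope, the slope with the new position,
and the coefficient of the equation enters through point masses c k at the
nodes.  These choices make the scheme coincide exactly with the recursion
found for the bridge in [bridge_damps]. *)
Fixpoint euler {R : realType} (dt : R) (c : nat -> R) (k : nat) : R * R :=
  if k is k'.+1 then
    let p := (euler dt c k').1 + dt * (euler dt c k').2 in
    (p, (euler dt c k').2 + 2 * c k * p)
  else (0, 1).

Section euler_convergence.
Context {R : realType} (q G G' h : R -> R) (M : R).
Hypothesis qM : forall x, 0 <= q x <= M.
Hypothesis dG : forall x : R, is_derive x 1 G (G' x).
Hypothesis dG' : forall x : R, is_derive x 1 G' (h x).
Hypothesis ch : continuous h.
Hypothesis hE : forall x, 0 <= x <= 1 -> h x = 2 * q x * G x.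
Hypothesis G0 : G 0 = 0.
Hypothesis G'0 : G' 0 = 1.

(** The modulus of continuity w is added to the error so that the sum is multiplied
by at most 1 + (2 M + 2) dt at each step, with no remainder. *)
Lemma euler_error (n : nat) (dt w : R) : 0 < dt -> n.+1%:R * dt = 1 -> 0 <= w ->
  (forall x y, x \in `[0, 1] -> y \in `[0, 1] -> `|x - y| <= dt ->
    `|G' x - G' y| <= w /\ `|h x - h y| <= w) ->
  forall k, (k <= n.+1)%N ->
  let e := euler dt (fun k => dt * q (k%:R * dt)) k in
  `|e.1 - G (k%:R * dt)| + `|e.2 - G' (k%:R * dt)| + w <=
  w * expR ((2 * M + 2) * (k%:R * dt)).
Proof.
move=> dt0 ndt w0 mod; have M0 : 0 <= M by have /andP[] := qM 0; exact: le_trans.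
have dt1 : dt <= 1 by rewrite -[leRHS]ndt ler_peMl ?ler1n// ltW.
elim=> [|k IH] kn.
  by rewrite /= mul0r G0 G'0 !subrr normr0 mulr0 expR0 !add0r mulr1.
have {IH} := IH (ltnW kn); cbn zeta; set c := fun k : nat => _.
have -> : euler dt c k.+1 = ((euler dt c k).1 + dt * (euler dt c k).2,
  (euler dt c k).2 + 2 * (dt * q (k.+1%:R * dt)) * ((euler dt c k).1 + dt * (euler dt c k).2)) by [].
move: (euler dt c k) => [p s] /=.
set t := k%:R * dt; have -> : k.+1%:R * dt = t + dt by rewrite -natr1 mulrDl mul1r.
have t0 : 0 <= t by rewrite mulr_ge0// ltW.
have t1 : t + dt <= 1.
  have -> : t + dt = k.+1%:R * dt by rewrite -natr1 mulrDl mul1r.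
  by rewrite -[leRHS]ndt ler_pM2r// ler_nat.
have tt : t <= t + dt by rewrite lerDl ltW.
move: (qM (t + dt)) => /andP[q0 qM'] IH.
have E1 : `|G (t + dt) - G t - dt * G' t| <= w * dt.
  have := @is_derive_increment _ _ _ t (t + dt) (G' t) w tt dG; rewrite addrC addrK; apply.
  move=> x /andP[tx xt]; have [|||+ _] := mod x t; last by [].
  + by rewrite in_itv/=; lra.
  + by rewrite in_itv/=; lra.
  + by rewrite ger0_norm; lra.
have E2 : `|G' (t + dt) - G' t - dt * h (t + dt)| <= w * dt.
  have := @is_derive_increment _ _ _ t (t + dt) (h (t + dt)) w tt dG'; rewrite [_ - t]addrC addKr; apply.
  move=> x /andP[tx xt]; have [|||_ +] := mod x (t + dt); last by [].
  + by rewrite in_itv/=; lra.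
  + by rewrite in_itv/=; lra.
  + by rewrite ler0_norm; lra.
have e1 : `|p + dt * s - G (t + dt)| <= `|p - G t| + dt * `|s - G' t| + w * dt.
  have -> : p + dt * s - G (t + dt) = (p - G t) + dt * (s - G' t) -
    (G (t + dt) - G t - dt * G' t) by ring.
  apply: le_trans (ler_normB _ _) _; apply: lerD => //.
  by apply: le_trans (ler_normD _ _) _; rewrite normrM (gtr0_norm dt0).
have e2 : `|s + 2 * (dt * q (t + dt)) * (p + dt * s) - G' (t + dt)| <=
    `|s - G' t| + 2 * dt * M * `|p + dt * s - G (t + dt)| + w * dt.
  have -> : s + 2 * (dt * q (t + dt)) * (p + dt * s) - G' (t + dt) =
     (s - G' t) + 2 * dt * q (t + dt) * (p + dt * s - G (t + dt)) -
    (G' (t + dt) - G' t - dt * h (t + dt)).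
    by rewrite hE ?(le_trans t0)//; ring.
  apply: le_trans (ler_normB _ _) _; apply: lerD => //.
  apply: le_trans (ler_normD _ _) _; rewrite lerD2l normrM ler_wpM2r//.
  by rewrite ger0_norm ?mulr_ge0 ?(ltW dt0)// ler_wpM2l ?mulr_ge0 ?(ltW dt0).
move: IH e1 e2; have := normr_ge0 (p - G t); have := normr_ge0 (s - G' t).
move: `|p - G t| `|s - G' t| `|p + _ - _| `|s + _ - _| => e d e' d' d0 e0 IH e1 e2.
rewrite mulrDr expRD mulrA.
have ex := expR_ge1Dx ((2 * M + 2) * dt).
have step : e' + d' + w <= (e + d + w) * (1 + (2 * M + 2) * dt).
  have h1 : 0 <= 2 * dt * M by rewrite !mulr_ge0 ?(ltW dt0).
  have h2 : 2 * dt * M * e' <= 2 * dt * M * (e + dt * d + w * dt) by rewrite ler_wpM2l.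
  have h3 : (dt * d) * (2 * dt * M) <= d * (2 * dt * M).
    by rewrite ler_wpM2r// ler_piMl.
  have h4 : (w * dt) * (2 * dt * M) <= w * (2 * dt * M).
    by rewrite ler_wpM2r// ler_piMr.
  have h5 : 0 <= e * dt by rewrite mulr_ge0// ltW.
  have h6 : 0 <= d * dt by rewrite mulr_ge0// ltW.
  lra.
apply: le_trans step _; apply: ler_pM => //.
- by rewrite !addr_ge0.
- by rewrite addr_ge0// mulr_ge0 ?addr_ge0 ?mulr_ge0// ltW.
Qed.

Lemma euler_cvg :
  (euler n.+1%:R^-1 (fun k => n.+1%:R^-1 * q (k%:R / n.+1%:R)) n.+1).1
    @[n --> \oo] --> G 1.
Proof.
have cG' := is_derive_continuous dG'.
apply/cvgrPdist_le => e e0; pose w := e / expR (2 * M + 2).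
have w0 : 0 < w by rewrite divr_gt0 ?expR_gt0.
have [d1 d10 D1] := unif_continuous_itv 0 1 cG' w0.
have [d2 d20 D2] := unif_continuous_itv 0 1 ch w0.
near=> n.
have nd : n.+1%:R^-1 < Num.min d1 d2.
  near: n; apply: (@cvgr_lt _ _ _ _ (fun n => n.+1%:R^-1) 0).
    exact: cvg_harmonic.
  by rewrite lt_min d10.
have n0 : 0 < n.+1%:R^-1 :> R by rewrite invr_gt0.
have n1 : n.+1%:R * n.+1%:R^-1 = 1 :> R by rewrite divff.
have := @euler_error n n.+1%:R^-1 w n0 n1 (ltW w0).
rewrite lt_min in nd; move/andP: nd => [nd1 nd2].
move=> /(_ _ n.+1 (leqnn _)); cbn zeta; rewrite n1 mulr1.
rewrite divfK ?gt_eqF ?expR_gt0// distrC.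
move=> /(_ _)/(le_trans _); apply.
  by rewrite -addrA lerDl addr_ge0// ltW.
move=> x y x01 y01 xy; split.
- by apply: D1 => //; exact: le_lt_trans nd1.
- by apply: D2 => //; exact: le_lt_trans nd2.
Unshelve. all: by end_near. Qed.

End euler_convergence.

Lemma volterra_euler_cvg {R : realType} (q g : R -> R) (M : R) :
  continuous q -> (forall x, 0 <= q x <= M) -> continuous g ->
  (forall x, g x = volterra q g x) ->
  (euler n.+1%:R^-1 (fun k => n.+1%:R^-1 * q (k%:R / n.+1%:R)) n.+1).1
    @[n --> \oo] --> g 1.
Proof.
move=> cq qM cg gE; pose h s := 2 * q s * g s.
have ch : continuous h by exact: continuous_volterra_density.
pose G (x : R) := x + prim (prim h) x.
pose G' (x : R) := 1 + prim h x.
have gG x : x \in `[0, 1] -> g x = G x by move=> x1; rewrite gE /volterra clamp_id.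
have dG (x : R) : is_derive x 1 G (G' x).
  exact: (is_deriveD (is_derive_id x 1) (is_derive_prim x (continuous_prim ch))).
have dG' (x : R) : is_derive x 1 G' (h x).
  rewrite -[h x]add0r.
  exact: (is_deriveD (is_derive_cst (1 : R) x 1) (is_derive_prim x ch)).
rewrite gG ?in_itv/= ?ler01 ?lexx//.
apply: (euler_cvg qM dG dG' ch).
- by move=> x x1; rewrite /h gG// in_itv.
- by rewrite /G prim0 addr0.
- by rewrite /G' prim0 addr0.
Qed.

(** * Integrals against densities, laws and products *)

Lemma le_integral_ge0 {d} {T : measurableType d} {R : realType}
    (mu : {measure set T -> \bar R}) (f g : T -> \bar R) :
  (forall x, 0 <= f x)%E -> (forall x, f x <= g x)%E ->
  (\int[mu]_x f x <= \int[mu]_x g x)%E.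
Proof.
move=> f0 fg; have g0 x : (0 <= g x)%E by exact: le_trans (f0 x) (fg x).
rewrite !ge0_integralTE//; apply: ub_ereal_sup => _ /= [h hf <-].
by apply: ereal_sup_ubound => /=; exists h => // x; exact: le_trans (hf x) (fg x).
Qed.

(** Made for an f whose behaviour on the null set N is out of control, such as a
functional of the discontinuous paths of a process.  Enclosing f between two
functions suffices, because the integral of nonnegative functions, a supremum
over simple functions below, is monotone even where measurability fails. *)
Lemma integral_off_negligible {d} {T : measurableType d} {R : realType}
    (mu : {measure set T -> \bar R}) (N : set T) (f g : T -> \bar R) :
  measurable N -> mu N = 0%E -> measurable_fun setT g ->
  (forall x, 0 <= f x)%E -> (forall x, 0 <= g x)%E -> (forall x, ~ N x -> f x = g x) ->
  (\int[mu]_x f x = \int[mu]_x g x)%E.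
Proof.
move=> mN N0 mg f0 g0 fg.
(* Two measurable functions that agree with g off N and enclose f. *)
pose lo x : \bar R := if x \in N then 0%E else g x.
pose hi x : \bar R := if x \in N then +oo%E else g x.
have mlo : measurable_fun setT lo.
  by apply: measurable_fun_ifT => //; apply: (measurable_fun_bool true); rewrite setTI preimage_mem_true.
have mhi : measurable_fun setT hi.
  by apply: measurable_fun_ifT => //; apply: (measurable_fun_bool true); rewrite setTI preimage_mem_true.
have aelo : (\int[mu]_x lo x = \int[mu]_x g x)%E.
  apply: ae_eq_integral => //; exists N; split => // x /=; apply: contra_notP => xN _.
  by rewrite /lo memNset.
have aehi : (\int[mu]_x hi x = \int[mu]_x g x)%E.
  apply: ae_eq_integral => //; exists N; split => // x /=; apply: contra_notP => xN _.
  by rewrite /hi memNset.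
apply/eqP; rewrite eq_le -{1}aehi -{1}aelo; apply/andP; split.
  apply: le_integral_ge0 => // x; rewrite /hi; case: ifPn => [_|/negP xN]; first by rewrite leey.
  by rewrite fg// => Nx; apply: xN; rewrite inE.
apply: le_integral_ge0 => x; rewrite /lo; case: ifPn => [//|/negP xN] //.
by rewrite fg// => Nx; apply: xN; rewrite inE.
Qed.

(** The density agrees almost everywhere with the Radon-Nikodym derivative, for
which the change of variables is known. *)
Lemma integral_density {R : realType}
    (nu : {finite_measure set (measurableTypeR R) -> \bar R}) (f : R -> R) :
  measurable_fun [set: measurableTypeR R] f -> (forall x, 0 <= f x) ->
  has_lebesgue_density nu f ->
  forall (E : set (measurableTypeR R)) (g : R -> R), measurable E ->
  nu.-integrable E (EFin \o g) ->
  (\int[nu]_(x in E) (g x)%:E = \int[@lebesgue_measure R]_(x in E) (g x * f x)%:E)%E.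
Proof.
move=> mf f0 nuf E g mE ig.
have numu : nu `<< @lebesgue_measure R.
  apply/null_content_dominatesP => A mA A0; rewrite nuf//.
  apply: null_set_integral => //.
  by apply/measurable_EFinP; exact: measurable_funTS.
have mg : measurable_fun E g by apply/measurable_EFinP; exact: measurable_int ig.
have intf : (@lebesgue_measure R).-integrable setT (EFin \o f).
  apply/integrableP; split; first exact/measurable_EFinP.
  under eq_integral do rewrite /= ger0_norm//.
  by rewrite -nuf// ltey_eq fin_num_measure.
rewrite -(Radon_Nikodym_change_of_variables numu mE ig).
apply: ae_eq_integral => //.
- apply: emeasurable_funM => //; first exact/measurable_EFinP.
  by apply: measurable_funTS; exact: measurable_int (Radon_Nikodym_integrable _).
- apply/measurable_EFinP; apply: measurable_funM => //; exact: measurable_funTS.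
have RNf : ae_eq (@lebesgue_measure R) setT
    (Radon_Nikodym (charge_of_finite_measure nu) (@lebesgue_measure R)) (EFin \o f).
  apply: integral_ae_eq => //.
  - exact: Radon_Nikodym_integrable.
  - exact/measurable_EFinP.
  - by move=> A _ mA; rewrite -Radon_Nikodym_integral//= -nuf.
by move: RNf; apply: filterS => x Hx Ex /=; rewrite Hx// EFinM.
Qed.

Lemma Rintegral_density {R : realType}
    (nu : {finite_measure set (measurableTypeR R) -> \bar R}) (f : R -> R) :
  measurable_fun [set: measurableTypeR R] f -> (forall x, 0 <= f x) ->
  has_lebesgue_density nu f ->
  forall (E : set (measurableTypeR R)) (g : R -> R), measurable E ->
  nu.-integrable E (EFin \o g) ->
  \int[nu]_(x in E) (g x) = \int[@lebesgue_measure R]_(x in E) (g x * f x).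
Proof.
by move=> mf f0 nuf E g mE ig; rewrite /Rintegral (integral_density mf f0 nuf mE ig).
Qed.

Lemma integral_clipped_density {R : realType}
    (mu : {finite_measure set (measurableTypeR R) -> \bar R}) (q : R -> R) :
  continuous q -> (forall x, 0 <= q x) ->
  has_lebesgue_density mu (fun t => q t * \1_`[0, 1] t) ->
  forall (E : set (measurableTypeR R)) (g : R -> R), measurable E -> E `<=` `[0, 1] ->
  continuous g ->
  \int[mu]_(t in E) g t = \int[@lebesgue_measure R]_(t in E) (g t * q t).
Proof.
move=> cq q0 muq E g mE E01 cg.
have [K K0 gK] := continuous_bounded_itv ler01 (continuous_subspaceT cg).
have mf : measurable_fun setT (fun t => q t * \1_`[0, 1] t).
  apply: measurable_funM; first exact: continuous_measurable_fun.
  exact: measurable_indic.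
have iK : mu.-integrable E (EFin \o cst K) by exact: finite_measure_integrable_cst.
have ig : mu.-integrable E (EFin \o g).
  apply: (le_integrable mE _ _ iK).
    by apply/measurable_EFinP; apply: measurable_funTS; exact: continuous_measurable_fun.
  by move=> t Et; rewrite /= lee_fin (le_trans (gK t (E01 _ Et)))// ler_norm.
rewrite (Rintegral_density mf _ muq mE ig).
  apply: eq_Rintegral => t; rewrite inE => Et.
  by rewrite indicE mem_set ?mulr1//; exact: E01.
by move=> t; rewrite mulr_ge0// indicE.
Qed.

Lemma law_transfer {d} {T : measurableType d} {R : realType} (P : probability T R)
    (X : T -> R) (Q : {finite_measure set (measurableTypeR R) -> \bar R}) (g : R -> R) :
  measurable_fun setT X ->
  (forall A : set (measurableTypeR R), measurable A -> pushforward P X A = Q A) ->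
  measurable_fun setT g ->
  P.-integrable setT (EFin \o (g \o X)) ->
  Q.-integrable setT (EFin \o g) /\ \int[P]_w g (X w) = \int[Q]_x g x.
Proof.
move=> mX XQ mg ig.
pose X' : {mfun T >-> measurableTypeR R} :=
  HB.pack X (@isMeasurableFun.Build _ _ T (measurableTypeR R) X mX).
have eqm (h : R -> \bar R) : (\int[pushforward P X']_x h x = \int[Q]_x h x)%E.
  by apply: eq_measure_integral => A mA _; exact: XQ.
have mEg : measurable_fun setT (EFin \o g : measurableTypeR R -> \bar R).
  exact/measurable_EFinP.
split; last by rewrite /Rintegral -eqm integral_pushforward.
apply/integrableP; split => //.
rewrite -eqm ge0_integral_pushforward//; first by move/integrableP : ig => [].
exact: measurableT_comp.
Qed.

Lemma Rintegral_cst_prob {d} {T : measurableType d} {R : realType}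
    (P : probability T R) (m : R) : \int[P]_w m = m.
Proof. by rewrite /Rintegral integral_cst//= probability_setT mule1. Qed.

Lemma integrable_bounded {d} {T : measurableType d} {R : realType}
    (P : probability T R) (f : T -> R) (k : R) : measurable_fun setT f ->
  (forall w, `|f w| <= k) -> P.-integrable setT (EFin \o f).
Proof.
move=> mf fk.
have i0 : P.-integrable setT (EFin \o cst k) by exact: finite_measure_integrable_cst.
apply: (le_integrable measurableT _ _ i0); first exact/measurable_EFinP.
by move=> w _; rewrite /= lee_fin (le_trans (fk w))// ler_norm.
Qed.

Lemma Rintegral_swap {d d'} {T : measurableType d} {S : measurableType d'} {R : realType}
    (P : probability T R) (Q : probability S R) (f : T * S -> R) (k : R) :
  measurable_fun setT f -> (forall z, `|f z| <= k) ->
  \int[P]_x (\int[Q]_y f (x, y)) = \int[Q]_y (\int[P]_x f (x, y)).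
Proof.
move=> mf fk.
pose PQ : subprobability (T * S)%type R :=
  product_subprobability ((P : subprobability T R), (Q : subprobability S R)).
have i0 : PQ.-integrable setT (EFin \o cst k) by exact: finite_measure_integrable_cst.
have i1 : (P \x Q)%E.-integrable setT (EFin \o f).
  apply: (le_integrable measurableT _ _ i0); first exact/measurable_EFinP.
  by move=> z _; rewrite /= lee_fin (le_trans (fk z))// ler_norm.
have ix x : Q.-integrable setT (EFin \o (fun y => f (x, y))).
  by apply: (@integrable_bounded _ _ _ _ _ k) => //; exact: measurableT_comp.
have iy y : P.-integrable setT (EFin \o (fun x => f (x, y))).
  by apply: (@integrable_bounded _ _ _ _ _ k) => //; exact: measurableT_comp.
rewrite [LHS]/Rintegral [RHS]/Rintegral; congr fine.
transitivity (\int[P]_x \int[Q]_y (f (x, y))%:E)%E.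
  apply: eq_integral => x _; rewrite /Rintegral fineK//.
  exact: integrable_fin_num (ix x).
rewrite (Fubini i1).
apply: eq_integral => y _; rewrite /Rintegral fineK//.
exact: integrable_fin_num (iy y).
Qed.

(** * Integrals of normal densities *)

Section normal.
Context {R : realType} (m s : R).
Hypothesis s0 : 0 < s.
Let N := normal_pdf m s.
Local Notation lam := (@lebesgue_measure R).

Lemma normal_pdf_def x : N x = normal_peak s * expR (- (x - m) ^+ 2 / (s ^+ 2 *+ 2)).
Proof. by rewrite /N normal_pdfE// gt_eqF. Qed.

Lemma is_derive_normal_pdf (x : R) : is_derive x 1 N (- (x - m) / s ^+ 2 * N x).
Proof.
have sn0 : s != 0 by rewrite gt_eqF.
have d1 (y : R) : is_derive y 1 (fun y : R => - (y - m) ^+ 2 / (s ^+ 2 *+ 2))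
    (- (y - m) / s ^+ 2).
  have dl := is_derive_affine 1 (- m) y.
  have := is_deriveZ (- (s ^+ 2 *+ 2)^-1) (is_deriveM dl dl).
  rewrite /GRing.scale/= => H.
  have -> : - (y - m) / s ^+ 2 = - (s ^+ 2 *+ 2)^-1 * ((1 * y - m) * 1 + (1 * y - m) * 1).
    by field.
  have -> : (fun y : R => - (y - m) ^+ 2 / (s ^+ 2 *+ 2)) =
     - (s ^+ 2 *+ 2)^-1 \*: ((fun y : R => 1 * y - m) * (fun y : R => 1 * y - m)).
    apply/funext => z.
    transitivity (- (s ^+ 2 *+ 2)^-1 * ((1 * z - m) * (1 * z - m))); last by [].
    by rewrite mul1r expr2 mulNr mulrC mulNr.
  exact: H.
have -> : N = normal_peak s \*: (expR \o (fun y : R => - (y - m) ^+ 2 / (s ^+ 2 *+ 2))).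
  by apply/funext => y; rewrite normal_pdf_def.
have := is_deriveZ (normal_peak s) (is_derive1_comp (is_derive_expR _) (d1 x)).
rewrite /GRing.scale/= mulrA.
by rewrite [in X in is_derive _ _ _ X]mulrC.
Qed.

(** A normal density of larger variance absorbs quadratic factors; integrability
of moments reduces to that of a density. *)
Lemma normal_pdf_weight_le : exists2 K, 0 <= K &
  forall x, (1 + `|x - m|) ^+ 2 * N x <= K * normal_pdf m (Num.sqrt 2 * s) x.
Proof.
have s20 : 0 < Num.sqrt 2 * s :> R by rewrite mulr_gt0 ?sqrtr_gt0.
have p0 := normal_peak_gt0 (lt0r_neq0 s0); have p20 := normal_peak_gt0 (lt0r_neq0 s20).
have ss : 0 < 4 * s ^+ 2 by rewrite mulr_gt0 ?exprn_gt0.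
exists ((2 + 8 * s ^+ 2) * (normal_peak s / normal_peak (Num.sqrt 2 * s))).
  by rewrite mulr_ge0 ?addr_ge0 ?mulr_ge0 ?invr_ge0 ?exprn_ge0// ?normal_peak_ge0// ltW.
move=> x; rewrite normal_pdf_def normal_pdfE ?gt_eqF// /normal_fun.
have X (a b c e : R) : c != 0 -> a * (b / c) * (c * e) = b * (a * e) by move=> ?; field.
rewrite X ?gt_eqF// exprMn sqr_sqrtr// (mulrCA (_ ^+ 2)) ler_pM2l// {X}.
set y := x - m; rewrite [leLHS](_ : _ = (1 + `|y|) ^+ 2 * expR (- (y ^+ 2 / (4 * s ^+ 2))) *
    expR (- y ^+ 2 / ((2 * s ^+ 2) *+ 2))); last first.
  by rewrite -mulrA -expRD; congr (_ * expR _); field; rewrite gt_eqF.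
rewrite ler_wpM2r ?expR_ge0// expRN ler_pdivrMr ?expR_gt0//.
have E := expR_ge1Dx (y ^+ 2 / (4 * s ^+ 2)).
have y0 : 0 <= y ^+ 2 / (4 * s ^+ 2) by rewrite divr_ge0 ?sqr_ge0// ltW.
have yE : y ^+ 2 = (y ^+ 2 / (4 * s ^+ 2)) * (4 * s ^+ 2) by rewrite divfK// gt_eqF.
have H1 : (1 + `|y|) ^+ 2 <= 2 + 2 * y ^+ 2.
  have := sqr_ge0 (1 - `|y|); rewrite sqrrB sqrrD !expr1n mul1r real_normK ?num_real//.
  by lra.
apply: le_trans H1 _; move: yE y0 E.
move: (y ^+ 2 / _) (expR _) => u e -> u0 ue.
rewrite [leRHS]mulrDl; apply: lerD; first by lra.
rewrite [leLHS](_ : _ = 8 * s ^+ 2 * u); last by ring.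
by apply: ler_wpM2l; [rewrite mulr_ge0 ?sqr_ge0|lra].
Qed.

Lemma normal_pdf_decay : exists K, 0 <= K /\
  forall x, (1 + `|x - m|) * N x <= K / (1 + `|x - m|).
Proof.
have [K K0 HK] := normal_pdf_weight_le.
have s20 : 0 < Num.sqrt 2 * s :> R by rewrite mulr_gt0 ?sqrtr_gt0.
exists (K * normal_peak (Num.sqrt 2 * s)); split.
  by rewrite mulr_ge0 ?normal_peak_ge0.
move=> x; rewrite ler_pdivlMr ?ltr_pwDl// mulrAC -expr2.
by apply: le_trans (HK x) _; rewrite ler_wpM2l// normal_pdf_ub// gt_eqF.
Qed.

Lemma normal_weight_integrable (f : R -> R) (k : R) : measurable_fun setT f ->
  (forall x, `|f x| <= k * (1 + `|x - m|) ^+ 2) ->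
  lam.-integrable setT (fun x => (f x * N x)%:E).
Proof.
move=> mf fk; have [K K0 HK] := normal_pdf_weight_le.
have k0 : 0 <= k.
  have := le_trans (normr_ge0 _) (fk m); rewrite subrr normr0 addr0 expr1n mulr1 //.
have ig := integrableZl measurableT (k * K) (integrable_normal_pdf m (Num.sqrt 2 * s)).
apply: (le_integrable measurableT _ _ ig).
- apply/measurable_EFinP; apply: measurable_funM => //; exact: measurable_normal_pdf.
- move=> x _; rewrite /= lee_fin normrM (ger0_norm (normal_pdf_ge0 _ _ _)).
  apply: le_trans (ler_norm _).
  apply: le_trans (_ : k * ((1 + `|x - m|) ^+ 2 * N x) <= _).
    by rewrite mulrA ler_wpM2r ?normal_pdf_ge0.
  by rewrite -[leRHS]mulrA ler_wpM2l.
Qed.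

(** The integral over [-n, n] is the increment of F N, which tends to 0 by the
decay of N. *)
Lemma normal_Rintegral_derive (F f : R -> R) (k : R) : continuous f ->
  (forall x : R, is_derive x 1 (fun x => F x * N x) (f x * N x)) ->
  (forall x, `|F x| <= k * (1 + `|x - m|)) ->
  (forall x, `|f x| <= k * (1 + `|x - m|) ^+ 2) ->
  \int[lam]_x (f x * N x) = 0.
Proof.
move=> cf dF Fk fk.
have mf : measurable_fun [set: R] f by exact: continuous_measurable_fun.
have if_ := normal_weight_integrable mf fk.
have cN : continuous N by apply: continuous_normal_pdf; rewrite gt_eqF.
have cfN : continuous (fun x => f x * N x).
  by move=> x; apply: cvgM; [exact: cf|exact: cN].
pose g (n : nat) (x : R) := ((fun x => f x * N x) \_ `[- n%:R, n%:R]) x.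
have nn n : - n%:R <= n%:R :> R by rewrite (le_trans (_ : _ <= 0)) ?oppr_le0.
have ig n : lam.-integrable setT (EFin \o g n).
  rewrite /g -restrict_EFin; apply/integrable_restrict => //.
  by rewrite setTI; exact: continuous_integrable.
have gE n : (\int[lam]_x (g n x)%:E = (F n%:R * N n%:R - F (- n%:R) * N (- n%:R))%:E)%E.
  rewrite -(Rintegral_is_derive (nn n) cfN dF) Rintegral_mkcond /Rintegral fineK//.
  exact: integrable_fin_num (ig n).
have [K [K0 HK]] := normal_pdf_decay.
have k0 : 0 <= k.
  by have := le_trans (normr_ge0 _) (Fk m); rewrite subrr normr0 addr0 mulr1.
have decay (x : nat -> R) : (forall n, n%:R - `|m| <= `|x n - m|) ->
    F (x n) * N (x n) @[n --> \oo] --> (0 : R).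
  move=> xm; apply/cvgr0Pnorm_le => e e0; near=> n.
  rewrite normrM (ger0_norm (normal_pdf_ge0 _ _ _)).
  apply: le_trans (ler_wpM2r (normal_pdf_ge0 _ _ _) (Fk _)) _.
  rewrite -mulrA; apply: le_trans (ler_wpM2l k0 (HK _)) _.
  rewrite mulrA ler_pdivrMr ?ltr_pwDl// -ler_pdivrMl// (mulrC e^-1).
  have : k * K / e + `|m| <= n%:R by near: n; exact: nbhs_infty_ger.
  by have := xm n; lra.
have [|||||_ _] := @dominated_convergence _ _ _ lam setT measurableT (fun n x => (g n x)%:E)
  (fun x => (f x * N x)%:E) (fun x => `|f x * N x|%:E).
- by move=> n; exact: measurable_int (ig n).
- exact: measurable_int if_.
- apply: aeW => x _; apply: cvg_near_cst; near=> n; rewrite /g patchE ifT// inE/= in_itv/=.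
  have : `|x| <= n%:R by near: n; exact: nbhs_infty_ger.
  by rewrite ler_norml.
- exact: integrable_abse if_.
- apply: aeW => x n _; rewrite lee_fin /g patchE; case: ifPn => // _.
  by rewrite normr0.
rewrite /= => H1.
have H2 : (\int[lam]_x (g n x)%:E)%E @[n --> \oo] --> 0%:E.
  under eq_fun do rewrite gE.
  apply: cvg_EFin; first exact: nearW.
  rewrite -[X in _ --> X](subr0 0); apply: cvgB.
  + apply: (decay (fun n => n%:R)) => n.
    by apply: le_trans (lerB_dist _ _); rewrite lerD2r ler_norm.
  + apply: (decay (fun n => - n%:R)) => n.
    by apply: le_trans (lerB_dist _ _); rewrite normrN lerD2r ler_norm.
have H3 : (\int[lam]_x (f x * N x)%:E)%E = 0%E.
  by have := cvg_lim _ H1; rewrite (cvg_lim _ H2)// => <-.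
by rewrite /Rintegral H3.
Unshelve. all: by end_near. Qed.

(** Stein's identity: the integrand is the derivative of F N.  The moments and the
cosine transform below come from suitable choices of F. *)
Lemma normal_stein (F F' : R -> R) (k : R) :
  (forall x : R, is_derive x 1 F (F' x)) -> continuous F' ->
  (forall x, `|F x| <= k * (1 + `|x - m|)) ->
  (forall x, `|F' x - F x * ((x - m) / s ^+ 2)| <= k * (1 + `|x - m|) ^+ 2) ->
  \int[lam]_x ((F' x - F x * ((x - m) / s ^+ 2)) * N x) = 0.
Proof.
move=> dF cF' Fk fk; apply: normal_Rintegral_derive Fk fk.
- have cF := is_derive_continuous dF.
  move=> x; apply: cvgB; first exact: cF'.
  apply: cvgM; first exact: cF.
  by apply: cvgM; [apply: cvgB; [exact: cvg_id|exact: cvg_cst]|exact: cvg_cst].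
- move=> x; have := is_deriveM (dF x) (is_derive_normal_pdf x).
  rewrite /GRing.scale/= => H.
  have -> : (F' x - F x * ((x - m) / s ^+ 2)) * N x =
    F x * (- (x - m) / s ^+ 2 * N x) + N x * F' x.
    by rewrite !mulNr; ring.
  exact: H.
Qed.

Lemma normal_Rintegral1 : \int[lam]_x N x = 1.
Proof. by rewrite /Rintegral integral_normal_pdf. Qed.

Let s2 : 0 < s ^+ 2. Proof. by rewrite exprn_gt0. Qed.

Lemma is_derive_cst0 (c x : R) : is_derive x 1 (fun=> c) (0 : R).
Proof. exact: is_derive_cst. Qed.

Lemma normal_mean : \int[lam]_x ((x - m) * N x) = 0.
Proof.
have := @normal_stein (fun=> - s ^+ 2) (fun=> 0) (s ^+ 2 + 1) (is_derive_cst0 _).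
have E x : 0 - - s ^+ 2 * ((x - m) / s ^+ 2) = x - m by field; rewrite gt_eqF.
under eq_Rintegral do rewrite E.
apply.
- by move=> ?; exact: cvg_cst.
- move=> x; rewrite normrN gtr0_norm//.
  by have := normr_ge0 (x - m); nra.
- move=> x; rewrite E.
  by have := normr_ge0 (x - m); move: (s ^+ 2) s2 `|_| => a a0 y; nra.
Qed.

Lemma normal_variance : \int[lam]_x ((x - m) ^+ 2 * N x) = s ^+ 2.
Proof.
have d (x : R) : is_derive x 1 (fun x => - s ^+ 2 * (x - m)) (- s ^+ 2).
  have := is_derive_affine (- s ^+ 2) (s ^+ 2 * m) x.
  by under eq_fun do rewrite -[X in _ + X]mulrNN -mulrDr.
have := @normal_stein _ _ (s ^+ 2 + 1) d.
have E x : - s ^+ 2 - - s ^+ 2 * (x - m) * ((x - m) / s ^+ 2) = (x - m) ^+ 2 - s ^+ 2.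
  by field; rewrite gt_eqF.
under eq_Rintegral do rewrite E mulrBl.
move=> H; have {}H : \int[lam]_x ((x - m) ^+ 2 * N x - s ^+ 2 * N x) = 0.
  apply: H.
  - by move=> ?; exact: cvg_cst.
  - move=> x; rewrite normrM normrN (gtr0_norm s2).
    by have := normr_ge0 (x - m); move: (s ^+ 2) s2 `|_| => a a0 y; nra.
  - move=> x; rewrite E; apply: le_trans (ler_normB _ _) _.
    rewrite ger0_norm ?sqr_ge0// (gtr0_norm s2) -(real_normK (num_real (x - m))).
    by have := normr_ge0 (x - m); move: (s ^+ 2) s2 `|_| => a a0 y; nra.
have i1 : lam.-integrable setT (EFin \o (fun x => (x - m) ^+ 2 * N x)).
  apply: (@normal_weight_integrable (fun x => (x - m) ^+ 2) 1).
    apply: continuous_measurable_fun => x.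
    by apply: cvgM; apply: cvgB; [exact: cvg_id|exact: cvg_cst|exact: cvg_id|exact: cvg_cst].
  move=> x; rewrite ger0_norm ?sqr_ge0// mul1r -(real_normK (num_real (x - m))).
  by have := normr_ge0 (x - m); move: `|_| => y; nra.
have i2 : lam.-integrable setT (EFin \o (fun x => s ^+ 2 * N x)).
  exact: (integrableZl measurableT (s ^+ 2) (integrable_normal_pdf m s)).
move: H; rewrite RintegralB// [X in _ - X]RintegralZl//; last exact: integrable_normal_pdf.
by rewrite normal_Rintegral1 mulr1 => /eqP; rewrite subr_eq0 => /eqP.
Qed.

Lemma normal_sin a : \int[lam]_x ((x - m) * sin (a * (x - m)) * N x) =
  a * s ^+ 2 * \int[lam]_x (cos (a * (x - m)) * N x).
Proof.
have da (x : R) : is_derive x 1 (fun x => a * (x - m)) a.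
  have := is_derive_affine a (- (a * m)) x.
  by under eq_fun do rewrite -mulrBr.
have d (x : R) : is_derive x 1 (fun x => - s ^+ 2 * sin (a * (x - m)))
    (- s ^+ 2 * (cos (a * (x - m)) * a)).
  exact: (is_deriveZ (- s ^+ 2) (is_derive1_comp (is_derive_sin _) (da x))).
have cl : continuous (fun x : R => a * (x - m)) by exact: is_derive_continuous da.
have cc : continuous (fun x : R => cos (a * (x - m))).
  by move=> x; apply: continuous_comp; [exact: cl|exact: continuous_cos].
have cs : continuous (fun x : R => sin (a * (x - m))).
  by move=> x; apply: continuous_comp; [exact: cl|exact: continuous_sin].
have := @normal_stein _ _ (s ^+ 2 * (1 + `|a|) + 1) d.
have E x : - s ^+ 2 * (cos (a * (x - m)) * a) - - s ^+ 2 * sin (a * (x - m)) * ((x - m) / s ^+ 2)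
   = (x - m) * sin (a * (x - m)) - a * s ^+ 2 * cos (a * (x - m)).
  by field; rewrite gt_eqF.
under eq_Rintegral do rewrite E mulrBl -(mulrA (a * s ^+ 2)).
move=> H.
have sc (x : R) : `|sin x| <= 1 /\ `|cos x| <= 1.
  by rewrite !ler_norml sin_geN1 sin_le1 cos_geN1 cos_le1.
have i1 : lam.-integrable setT (EFin \o (fun x => (x - m) * sin (a * (x - m)) * N x)).
  apply: (@normal_weight_integrable (fun x => (x - m) * sin (a * (x - m))) 1).
    apply: continuous_measurable_fun => x.
    by apply: cvgM; [apply: cvgB; [exact: cvg_id|exact: cvg_cst]|exact: cs].
  move=> x; rewrite normrM mul1r; have [sx _] := sc (a * (x - m)).
  apply: le_trans (ler_wpM2l (normr_ge0 _) sx) _; rewrite mulr1.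
  by have := normr_ge0 (x - m); move: `|_| => y; nra.
have i0 : lam.-integrable setT (EFin \o (fun x => cos (a * (x - m)) * N x)).
  apply: (@normal_weight_integrable (fun x => cos (a * (x - m))) 1).
    exact: continuous_measurable_fun.
  move=> x; rewrite mul1r; have [_ cx] := sc (a * (x - m)); apply: le_trans cx _.
  by have := normr_ge0 (x - m); move: `|_| => y; nra.
have i2 : lam.-integrable setT (EFin \o (fun x => a * s ^+ 2 * (cos (a * (x - m)) * N x))).
  exact: (integrableZl measurableT (a * s ^+ 2) i0).
apply/eqP; rewrite -subr_eq0 -RintegralZl// -RintegralB//; apply/eqP; apply: H.
- by move=> x; apply: cvgM; [exact: cvg_cst|apply: cvgM; [exact: cc|exact: cvg_cst]].
- move=> x; rewrite normrM normrN (gtr0_norm s2); have [sx _] := sc (a * (x - m)).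
  apply: le_trans (ler_wpM2l (ltW s2) sx) _; rewrite mulr1.
  have := normr_ge0 (x - m); have := normr_ge0 a; move: (s ^+ 2) s2 `|_| `|_| => b b0 v u u0 v0.
  have h1 : 0 <= b * u by rewrite mulr_ge0// ltW.
  have h2 : 0 <= (b * (1 + u) + 1) * v.
    by rewrite mulr_ge0// addr_ge0// mulr_ge0 ?addr_ge0// ltW.
  lra.
- move=> x; rewrite E; have [sx cx] := sc (a * (x - m)).
  apply: le_trans (ler_normB _ _) _.
  rewrite normrM (normrM (a * s ^+ 2)) (normrM a) (gtr0_norm s2).
  have h1 := ler_wpM2l (normr_ge0 (x - m)) sx.
  have h2 : `|a| * s ^+ 2 * `|cos (a * (x - m))| <= `|a| * s ^+ 2 * 1.
    by rewrite ler_wpM2l// mulr_ge0// ltW.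
  apply: le_trans (lerD h1 h2) _; rewrite !mulr1.
  have := normr_ge0 (x - m); have := normr_ge0 a; move: (s ^+ 2) s2 `|_| `|_| => b b0 v u u0 v0.
  have h3 : 0 <= b * v by rewrite mulr_ge0// ltW.
  have h4 : 0 <= u * b by rewrite mulr_ge0// ltW.
  have h5 : 0 <= (b * (1 + u) + 1) * (v * v + v).
    by rewrite mulr_ge0 ?addr_ge0 ?mulr_ge0 ?addr_ge0// ltW.
  nra.
Qed.

Let sincos_le1 (x : R) : `|sin x| <= 1 /\ `|cos x| <= 1.
Proof. by rewrite !ler_norml sin_geN1 sin_le1 cos_geN1 cos_le1. Qed.

Lemma is_derive_normal_cos (a : R) :
  is_derive a 1 (fun a => \int[lam]_x (cos (a * (x - m)) * N x))
    (- \int[lam]_x ((x - m) * sin (a * (x - m)) * N x)).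
Proof.
pose f (a x : R) : R := cos (a * (x - m)) * N x.
have df (x b : R) : is_derive b 1 (f ^~ x) (- ((x - m) * sin (b * (x - m)) * N x)).
  have dl := is_derive_affine (x - m) 0 b.
  have := is_deriveZ (N x) (is_derive1_comp (is_derive_cos _) dl).
  rewrite /GRing.scale/= addr0 => H.
  have -> : f ^~ x = N x \*: (cos \o (fun y : R => (x - m) * y + 0)).
    apply/funext => y; transitivity (N x * cos ((x - m) * y + 0)); last by [].
    by rewrite /f addr0 (mulrC (N x)) (mulrC y).
  have -> : - ((x - m) * sin (b * (x - m)) * N x) = N x * (- sin ((x - m) * b) * (x - m)).
    by rewrite (mulrC b); ring.
  exact: H.
have p1 b x : partial1of2 f b x = - ((x - m) * sin (b * (x - m)) * N x).
  by rewrite partial1of2E; exact: derive_val.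
have intf b : lam.-integrable setT (EFin \o f b).
  apply: (@normal_weight_integrable (fun x => cos (b * (x - m))) 1).
    apply: continuous_measurable_fun => x; apply: continuous_comp; last exact: continuous_cos.
    by apply: cvgM; [exact: cvg_cst|apply: cvgB; [exact: cvg_id|exact: cvg_cst]].
  move=> x; rewrite mul1r; have [_ cx] := sincos_le1 (b * (x - m)); apply: le_trans cx _.
  by have := normr_ge0 (x - m); move: `|_| => y; nra.
have intG : lam.-integrable setT (EFin \o (fun x => `|x - m| * N x)).
  apply: (@normal_weight_integrable (fun x => `|x - m|) 1).
    apply: continuous_measurable_fun => x; apply: (@continuous_comp _ _ _ (fun x : R => x - m) Num.norm); last exact: norm_continuous.
    by apply: cvgB; [exact: cvg_id|exact: cvg_cst].
  by move=> x; rewrite mul1r normr_id; have := normr_ge0 (x - m); move: `|_| => y; nra.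
have Ia : `](a - 1), (a + 1)[%classic a by rewrite /= in_itv/=; lra.
have G0 x : 0 <= `|x - m| * N x by rewrite mulr_ge0 ?normal_pdf_ge0.
have Gub b x : `](a - 1), (a + 1)[%classic b -> setT x -> `|partial1of2 f b x| <= `|x - m| * N x.
  move=> _ _; rewrite p1 normrN !normrM (ger0_norm (normal_pdf_ge0 _ _ _)).
  rewrite ler_wpM2r ?normal_pdf_ge0// ler_piMr//.
  by have [] := sincos_le1 (b * (x - m)).
have df' b x : `](a - 1), (a + 1)[%classic b -> setT x -> derivable (f ^~ x) b 1.
  by move=> _ _; have [] := df x b.
have intf' b : `](a - 1), (a + 1)[%classic b -> lam.-integrable setT (EFin \o f b) by [].
have D := derivable_under_integral measurableT Ia intf' df' G0 intG Gub.
have V := differentiation_under_integral measurableT Ia intf' df' G0 intG Gub.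
apply: DeriveDef D _; rewrite -derive1E V.
under eq_Rintegral do rewrite p1 -mulN1r.
rewrite RintegralZl ?mulN1r//.
apply: (@normal_weight_integrable (fun x => (x - m) * sin (a * (x - m))) 1).
  apply: continuous_measurable_fun => x.
  apply: cvgM; [apply: cvgB; [exact: cvg_id|exact: cvg_cst]|].
  apply: continuous_comp; last exact: continuous_sin.
  by apply: cvgM; [exact: cvg_cst|apply: cvgB; [exact: cvg_id|exact: cvg_cst]].
move=> x; rewrite normrM mul1r; have [sx _] := sincos_le1 (a * (x - m)).
apply: le_trans (ler_wpM2l (normr_ge0 _) sx) _; rewrite mulr1.
by have := normr_ge0 (x - m); move: `|_| => y; nra.
Qed.

(** By Stein's identity the transform satisfies phi' a = - a s ^ 2 phi a, so that
its product with exp (a ^ 2 s ^ 2 / 2) is constant. *)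
Lemma normal_cos (a : R) :
  \int[lam]_x (cos (a * (x - m)) * N x) = expR (- (a ^+ 2 * s ^+ 2 / 2)).
Proof.
pose phi (a : R) := \int[lam]_x (cos (a * (x - m)) * N x).
have dphi (b : R) : is_derive b 1 phi (- (b * s ^+ 2 * phi b)).
  by rewrite -normal_sin; exact: is_derive_normal_cos.
have dq (b : R) : is_derive b 1 (fun b : R => b ^+ 2 * s ^+ 2 / 2) (b * s ^+ 2).
  have dl := is_derive_affine 1 0 b.
  have H := is_deriveZ (s ^+ 2 / 2) (is_deriveM dl dl).
  have -> : (fun b : R => b ^+ 2 * s ^+ 2 / 2) =
      (s ^+ 2 / 2) \*: ((fun y : R => 1 * y + 0) * (fun y : R => 1 * y + 0)).
    apply/funext => y; transitivity (s ^+ 2 / 2 * ((1 * y + 0) * (1 * y + 0))); last by [].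
    by rewrite mul1r addr0; field.
  have -> : b * s ^+ 2 = (s ^+ 2 / 2) *: ((1 * b + 0) *: (1 : R) + (1 * b + 0) *: (1 : R)).
    by rewrite /GRing.scale/=; field.
  exact: H.
have dprod (b : R) : is_derive b 1 (fun b => phi b * expR (b ^+ 2 * s ^+ 2 / 2)) 0.
  have := is_deriveM (dphi b) (is_derive1_comp (is_derive_expR _) (dq b)).
  rewrite /GRing.scale/= => H.
  have -> : (0 : R) = phi b * (expR (b ^+ 2 * s ^+ 2 / 2) * (b * s ^+ 2)) +
     expR (b ^+ 2 * s ^+ 2 / 2) * - (b * s ^+ 2 * phi b) by ring.
  exact: H.
have := is_derive_0_is_cst a 0 dprod.
rewrite expr0n/= !mul0r expR0 mulr1 {2}/phi.
under eq_Rintegral do rewrite mul0r cos0 mul1r.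
rewrite normal_Rintegral1 expRN => E.
have e0 := lt0r_neq0 (expR_gt0 (a ^+ 2 * s ^+ 2 / 2)).
by apply: (mulIf e0); rewrite mulVf// -E.
Qed.

End normal.

(** Completing the square: a Gaussian tilt of the standard normal density is again
proportional to a normal density. *)
Lemma normal_quadraticE {R : realType} (b k x : R) : 0 <= k ->
  expR (- (b * x) - k * x ^+ 2 / 2) * normal_pdf 0 1 x =
  expR (b ^+ 2 / (2 * (1 + k))) / Num.sqrt (1 + k) *
  normal_pdf (- b / (1 + k)) (Num.sqrt (1 + k))^-1 x.
Proof.
move=> k0; have k1 : 0 < 1 + k by rewrite ltr_pwDl.
pose s := (Num.sqrt (1 + k))^-1.
have s0 : 0 < s by rewrite invr_gt0 sqrtr_gt0.
have s2 : s ^+ 2 = (1 + k)^-1 by rewrite exprVn sqr_sqrtr// ltW.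
have peakE : normal_peak 1 = s * normal_peak s.
  rewrite /normal_peak expr1n mul1r s2.
  rewrite -mulrnAr sqrtrM ?invr_ge0 ?(ltW k1)// sqrtrV ?(ltW k1)//.
  by rewrite invfM invrK mulrA mulVf ?mul1r// gt_eqF// sqrtr_gt0.
rewrite !normal_pdf_def// peakE subr0 s2 -/s.
rewrite mulrCA -!mulrA (mulrCA _ s); congr (_ * _); rewrite (mulrCA _ (normal_peak s)).
congr (_ * _); rewrite -!expRD; congr expR.
by field; rewrite gt_eqF.
Qed.

Lemma normal_quadratic_integrable {R : realType} (b k : R) : 0 <= k ->
  (@lebesgue_measure R).-integrable setT
    (fun x => (expR (- (b * x) - k * x ^+ 2 / 2) * normal_pdf 0 1 x)%:E).
Proof.
move=> k0; under eq_fun do rewrite normal_quadraticE//.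
exact: (integrableZl measurableT _ (integrable_normal_pdf _ _)).
Qed.

Lemma normal_quadratic {R : realType} (b k : R) : 0 <= k ->
  \int[@lebesgue_measure R]_x (expR (- (b * x) - k * x ^+ 2 / 2) * normal_pdf 0 1 x) =
  expR (b ^+ 2 / (2 * (1 + k))) / Num.sqrt (1 + k).
Proof.
move=> k0; under eq_Rintegral do rewrite normal_quadraticE//.
rewrite RintegralZl//; last exact: integrable_normal_pdf.
by rewrite normal_Rintegral1 mulr1.
Qed.

(** * Finite-dimensional laws of the Brownian bridge *)

(** For a centred law the characteristic function is real, and the cosine is all
that is needed of it.  Both the degenerate and the normal case have to be
matched with the mean and the variance. *)
Lemma gaussian_cos {d} {T : measurableType d} {R : realType} (P : probability T R)
    (X : T -> R) : measurable_fun setT X ->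
  P.-integrable setT (EFin \o (fun w => X w ^+ 2)) ->
  gaussian P X -> \int[P]_w X w = 0 ->
  \int[P]_w cos (X w) = expR (- (\int[P]_w (X w ^+ 2)) / 2).
Proof.
move=> mX iX2 gX EX.
have iX : P.-integrable setT (EFin \o X).
  have i1 : P.-integrable setT (EFin \o (fun w => 1 + X w ^+ 2)).
    have i0 : P.-integrable setT (EFin \o cst 1) by exact: finite_measure_integrable_cst.
    exact: (integrableD measurableT i0 iX2).
  apply: (le_integrable measurableT _ _ i1); first exact/measurable_EFinP.
  move=> w _; rewrite /= lee_fin [leRHS]ger0_norm ?addr_ge0 ?sqr_ge0//.
  by rewrite -(real_normK (num_real (X w))); have := normr_ge0 (X w); move: `|_| => y; nra.
have mc : measurable_fun setT (cos : R -> R).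
  by apply: continuous_measurable_fun; exact: continuous_cos.
have ic : P.-integrable setT (EFin \o (cos \o X)).
  apply: (@integrable_bounded _ _ _ _ _ 1); first exact: measurableT_comp mc mX.
  by move=> w; rewrite ler_norml cos_geN1 cos_le1.
have [m [Xm|[s s0 Xm]]] := gX.
- pose Q : {finite_measure set (measurableTypeR R) -> \bar R} :=
    dirac (m : measurableTypeR R).
  have mid : measurable_fun setT (id : R -> R) by [].
  have [_ E1] := law_transfer (Q := Q) mX Xm mid iX.
  have [_ E2] := law_transfer (Q := Q) mX Xm mc ic.
  have m2 : measurable_fun setT (fun x : R => x ^+ 2) by exact: measurable_funX.
  have [_ E3] := law_transfer (Q := Q) mX Xm m2 iX2.
  have dQ (g : R -> R) : measurable_fun setT g -> \int[Q]_x g x = g m.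
    move=> mg; rewrite /Rintegral integral_dirac//; last exact/measurable_EFinP.
    by rewrite diracT mul1e.
  have m0 : m = 0 by rewrite -(dQ id mid) -E1.
  by rewrite E2 E3 !dQ// m0 cos0 expr0n/= oppr0 mul0r expR0.
- have [_ E2] := law_transfer (Q := normal_prob m s) mX Xm mc ic.
  have nd : has_lebesgue_density (normal_prob m s) (normal_pdf m s) by [].
  have dQ (g : R -> R) : (normal_prob m s).-integrable setT (EFin \o g) ->
      \int[normal_prob m s]_x g x = \int[@lebesgue_measure R]_x (g x * normal_pdf m s x).
    by apply: Rintegral_density => //; [exact: measurable_normal_pdf|exact: normal_pdf_ge0].
  have mc' : measurable_fun setT (fun x : R => x - m) by exact: measurable_funB.
  have iXm : P.-integrable setT (EFin \o (fun w => X w - m)).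
    have i0 : P.-integrable setT (EFin \o cst m) by exact: finite_measure_integrable_cst.
    exact: (integrableB measurableT iX i0).
  have m0 : m = 0.
    have [i1 E1] := law_transfer (Q := normal_prob m s) mX Xm mc' iXm.
    move: E1; rewrite dQ// normal_mean// RintegralB//; last exact: finite_measure_integrable_cst.
    rewrite Rintegral_cst_prob EX sub0r => /eqP.
    by rewrite oppr_eq0 => /eqP.
  have m2 : measurable_fun setT (fun x : R => x ^+ 2) by exact: measurable_funX.
  have [i2 E3] := law_transfer (Q := normal_prob m s) mX Xm m2 iX2.
  have [i3 _] := law_transfer (Q := normal_prob m s) mX Xm mc ic.
  rewrite E2 E3 !dQ//.
  have xm (x : R) : x - m = x by rewrite m0 subr0.
  have := normal_variance m s0; have := normal_cos m s0 1.
  under eq_Rintegral do rewrite xm mul1r.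
  move=> ->; under eq_Rintegral do rewrite xm.
  by move=> ->; rewrite expr1n mul1r mulNr.
Qed.

Lemma integrable_sqrt_mul {d} {T : measurableType d} {R : realType}
    (P : probability T R) (X Y : T -> R) :
  measurable_fun setT X -> measurable_fun setT Y ->
  P.-integrable setT (EFin \o (fun w => X w ^+ 2)) ->
  P.-integrable setT (EFin \o (fun w => Y w ^+ 2)) ->
  P.-integrable setT (EFin \o (fun w => X w * Y w)).
Proof.
move=> mX mY iX iY; have i1 := integrableD measurableT iX iY.
apply: (le_integrable measurableT _ _ i1).
  by apply/measurable_EFinP; exact: measurable_funM.
move=> w _; rewrite /= lee_fin normrM [leRHS]ger0_norm ?addr_ge0 ?sqr_ge0//.
rewrite -(real_normK (num_real (X w))) -(real_normK (num_real (Y w))).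
by have := sqr_ge0 (`|X w| - `|Y w|); have := normr_ge0 (X w); have := normr_ge0 (Y w);
  move: `|X w| `|Y w| => x y; nra.
Qed.

Definition quad {R : realType} (n : nat) (K : nat -> nat -> R) (b : nat -> R) : R :=
  \sum_(j < n) \sum_(k < n) b j * b k * K j k.

Definition bridge_kernel {R : realType} (l : R) (t : nat -> R) (j k : nat) : R :=
  Num.min (t j) (t k) - t j * t k / l.

Section bridge_moments.
Context {d} {T : measurableType d} {R : realType} (P : probability T R) (l : R)
  (B : R -> {RV P >-> R}).
Hypothesis bB : brownian_bridge l B.

Lemma bridge_mean t : t \in `[0, l] -> \int[P]_w B t w = 0.
Proof.
move=> tl; have [_ /(_ t tl) + _ _] := bB.
by rewrite expectation_def /Rintegral => ->.
Qed.

Lemma bridge_cov s t : s \in `[0, l] -> t \in `[0, l] ->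
  (\int[P]_w (B s w * B t w)%:E)%E = (Num.min s t - s * t / l)%:E.
Proof.
move=> sl tl; have [_ E /(_ s t sl tl) <- _] := bB.
rewrite [in RHS]unlock !E// expectation_def.
apply: eq_integral => w _; congr EFin.
by transitivity ((B s w - 0) * (B t w - 0)); [rewrite !subr0|].
Qed.

Lemma bridge_square_integrable t : t \in `[0, l] ->
  P.-integrable setT (EFin \o (fun w => B t w ^+ 2)).
Proof.
move=> tl; apply/integrableP; split.
  by apply/measurable_EFinP; exact: measurable_funX.
rewrite (eq_integral (fun w => (B t w * B t w)%:E)) ?bridge_cov ?ltry//.
by move=> w _; rewrite /= ger0_norm ?sqr_ge0// expr2.
Qed.

Lemma bridge_mul_integrable s t : s \in `[0, l] -> t \in `[0, l] ->
  P.-integrable setT (EFin \o (fun w => B s w * B t w)).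
Proof.
by move=> sl tl; apply: integrable_sqrt_mul => //; exact: bridge_square_integrable.
Qed.

Lemma bridge_Rcov s t : s \in `[0, l] -> t \in `[0, l] ->
  \int[P]_w (B s w * B t w) = Num.min s t - s * t / l.
Proof. by move=> sl tl; rewrite /Rintegral bridge_cov. Qed.

Lemma bridge_integrable t : t \in `[0, l] -> P.-integrable setT (EFin \o B t).
Proof.
move=> tl; have i1 : P.-integrable setT (EFin \o (fun w : T => (1 : R) ^+ 2)).
  exact: finite_measure_integrable_cst.
have mB : measurable_fun setT (B t) by [].
have -> : B t = (fun w => cst 1 w * B t w) :> (T -> R).
  by apply/funext => w; rewrite mul1r.
exact: integrable_sqrt_mul (bridge_square_integrable tl).
Qed.

Lemma integrable_sum_nat (n : nat) (h : nat -> T -> R) :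
  (forall k, (k < n)%N -> P.-integrable setT (EFin \o h k)) ->
  P.-integrable setT (EFin \o (fun w => \sum_(k < n) h k w)) /\
  \int[P]_w (\sum_(k < n) h k w) = \sum_(k < n) \int[P]_w h k w.
Proof.
elim: n => [|n IH] ih.
  split; first by under eq_fun do rewrite big_ord0; exact: finite_measure_integrable_cst.
  by under eq_Rintegral do rewrite big_ord0; rewrite Rintegral_cst_prob big_ord0.
have [i1 E1] := IH (fun k kn => ih k (ltnW kn)).
have E : (fun w => \sum_(k < n.+1) h k w) = (fun w => \sum_(k < n) h k w + h n w).
  by apply/funext => w; rewrite big_ord_recr.
split.
  by rewrite E; exact: (integrableD measurableT i1 (ih n (ltnSn n))).
rewrite E RintegralD// ?E1 ?big_ord_recr//.
exact: ih.
Qed.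

(** These transforms carry all the information on the finite-dimensional laws that
is used: the weighted integrals of [gaussian_damps] are derived from them
without densities of Gaussian vectors, which need not exist here since the
bridge is degenerate at 0 and l. *)
Lemma bridge_cos (n : nat) (t b : nat -> R) :
  (forall k, (k < n)%N -> t k \in `[0, l]) ->
  \int[P]_w cos (\sum_(k < n) b k * B (t k) w) =
  expR (- quad n (bridge_kernel l t) b / 2).
Proof.
move=> tl; have [gB _ _ _] := bB.
have sqE w : (\sum_(k < n) b k * B (t k) w) ^+ 2 =
    \sum_(j < n) \sum_(k < n) b j * b k * (B (t j) w * B (t k) w).
  rewrite expr2 mulr_suml; apply: eq_bigr => j _; rewrite mulr_sumr.
  by apply: eq_bigr => k _; ring.
have i2 j k : (j < n)%N -> (k < n)%N ->
    P.-integrable setT (EFin \o (fun w => b j * b k * (B (t j) w * B (t k) w))).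
  move=> jn kn; exact: (integrableZl measurableT _ (bridge_mul_integrable (tl j jn) (tl k kn))).
have i3 j : (j < n)%N -> P.-integrable setT
    (EFin \o (fun w => \sum_(k < n) b j * b k * (B (t j) w * B (t k) w))).
  by move=> jn; have [] := @integrable_sum_nat n
    (fun k w => b j * b k * (B (t j) w * B (t k) w)) (fun k kn => i2 j k jn kn).
rewrite gaussian_cos.
- congr (expR (- _ / 2)); rewrite /quad /bridge_kernel; under eq_Rintegral do rewrite sqE.
  rewrite (integrable_sum_nat i3).2; apply: eq_bigr => j _.
  rewrite (@integrable_sum_nat n (fun k w => b j * b k * (B (t j) w * B (t k) w))
    (fun k kn => i2 j k (ltn_ord j) kn)).2.
  apply: eq_bigr => k _; rewrite RintegralZl//; last exact: bridge_mul_integrable (tl _ _) (tl _ _).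
  by rewrite bridge_Rcov// tl.
- by apply: measurable_sum => k; exact: measurable_funM.
- under eq_fun do rewrite sqE; exact: (integrable_sum_nat i3).1.
- by apply: (gB n (fun k => t k) (fun k => b k)) => k; exact: tl.
- have i1 k : (k < n)%N -> P.-integrable setT (EFin \o (fun w => b k * B (t k) w)).
    by move=> kn; exact: (integrableZl measurableT _ (bridge_integrable (tl k kn))).
  rewrite (integrable_sum_nat i1).2.
  apply: big1 => k _; rewrite RintegralZl//; last exact: bridge_integrable (tl _ _).
  by rewrite bridge_mean ?mulr0// tl.
Qed.

End bridge_moments.

Lemma std_normal_density {R : realType} (g : R -> R) (k : R) :
  measurable_fun setT g -> (forall x, `|g x| <= k) ->
  \int[normal_prob 0 1]_x g x = \int[@lebesgue_measure R]_x (g x * normal_pdf 0 1 x).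
Proof.
move=> mg gk; apply: (@Rintegral_density R (normal_prob 0 1)) => //.
- exact: measurable_normal_pdf.
- exact: normal_pdf_ge0.
- exact: (@integrable_bounded _ (measurableTypeR R) R (normal_prob 0 1) g k mg gk).
Qed.

Lemma std_normal_cos {R : realType} (u : R) :
  \int[normal_prob 0 1]_z cos (u * z) = expR (- (u ^+ 2 / 2)).
Proof.
rewrite (@std_normal_density _ (fun z => cos (u * z)) 1).
- have := @normal_cos R 0 1 ltr01 u; rewrite expr1n mulr1 => <-.
  by apply: eq_Rintegral => x _; rewrite subr0.
- apply: continuous_measurable_fun => x; apply: continuous_comp; last exact: continuous_cos.
  by apply: cvgM; [exact: cvg_cst|exact: cvg_id].
- by move=> x; rewrite ler_norml cos_geN1 cos_le1.
Qed.

(** * Gaussian vectors weighted by exponentials of squares *)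

Definition perturb {R : realType} (b : nat -> R) (x : R) (m : nat) : nat -> R :=
  fun k => b k + x * (k == m)%:R.

(** The covariance of a Gaussian vector after its law has been weighted by the
exponential of - c Y_m ^ 2: in terms of inverse covariances, 2 c is added to the
diagonal entry m, and this is the corresponding rank-one update. *)
Definition damp {R : realType} (K : nat -> nat -> R) (c : R) (m : nat) : nat -> nat -> R :=
  fun j k => K j k - 2 * c * K j m * K k m / (1 + 2 * c * K m m).

Lemma sum_perturb {R : realType} (n : nat) (b f : nat -> R) (x : R) (m : nat) : (m < n)%N ->
  \sum_(k < n) perturb b x m k * f k = \sum_(k < n) b k * f k + x * f m.
Proof.
move=> mn; rewrite /perturb; under eq_bigr do rewrite mulrDl.
rewrite big_split/=; congr (_ + _).
rewrite (bigD1 (Ordinal mn))//= eqxx mulr1 big1 ?addr0// => i im.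
by rewrite (_ : (i == m :> nat) = false) ?mulr0 ?mul0r//; apply/negbTE.
Qed.

Lemma quad_perturb {R : realType} (n : nat) (K : nat -> nat -> R) (b : nat -> R) (x : R)
    (m : nat) : (m < n)%N -> (forall j k, K j k = K k j) ->
  quad n K (perturb b x m) =
  quad n K b + 2 * x * (\sum_(j < n) b j * K j m) + x ^+ 2 * K m m.
Proof.
move=> mn Ksym.
have E c j : \sum_(k < n) c j * perturb b x m k * K j k =
    c j * (\sum_(k < n) b k * K j k + x * K j m).
  under eq_bigr do rewrite -mulrA.
  by rewrite -mulr_sumr sum_perturb.
rewrite /quad; under eq_bigr do rewrite E.
rewrite (sum_perturb b (fun j => \sum_(k < n) b k * K j k + x * K j m) x mn).
under eq_bigr do rewrite mulrDr.
rewrite big_split/=.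
under [X in X + _ + _ = _]eq_bigr do rewrite mulr_sumr.
under [X in _ + X + _ = _]eq_bigr do rewrite mulrCA.
rewrite -mulr_sumr.
under [X in _ + x * (X + _) = _]eq_bigr do rewrite Ksym.
under eq_bigr do (under eq_bigr do rewrite mulrA).
ring.
Qed.

Lemma quad_damp {R : realType} (n : nat) (K : nat -> nat -> R) (b : nat -> R) (c : R)
    (m : nat) :
  quad n (damp K c m) b =
  quad n K b - 2 * c / (1 + 2 * c * K m m) * (\sum_(j < n) b j * K j m) ^+ 2.
Proof.
rewrite /quad expr2 mulr_suml mulr_sumr -sumrB; apply: eq_bigr => j _.
rewrite !mulr_sumr -sumrB; apply: eq_bigr => k _.
by rewrite /damp; ring.
Qed.

(** A nonnegative weight G under which Y behaves as a Gaussian vector of covariance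
K and total mass C, as seen through cosine transforms.  One more factor
exp (- c Y_m ^ 2) preserves this form. *)
Section gaussian_damping.
Context {d} {T : measurableType d} {R : realType} (P : probability T R).
Variables (n : nat) (Y : nat -> T -> R) (G : T -> R) (K : nat -> nat -> R) (C : R).
Hypothesis mY : forall k, measurable_fun setT (Y k).
Hypothesis mG : measurable_fun setT G.
Hypothesis G01 : forall w, 0 <= G w <= 1.
Hypothesis Ksym : forall j k, K j k = K k j.
Hypothesis C0 : 0 < C.

Let S (b : nat -> R) w := \sum_(k < n) b k * Y k w.

Hypothesis GC : forall b, \int[P]_w (G w * cos (S b w)) = C * expR (- quad n K b / 2).

Let mS b : measurable_fun setT (S b).
Proof. by apply: measurable_sum => k; exact: measurable_funM. Qed.

Let mcos (f : T -> R) : measurable_fun setT f -> measurable_fun setT (fun w => cos (f w)).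
Proof.
move=> mf; have mc : measurable_fun setT (cos : R -> R).
  by apply: continuous_measurable_fun; exact: continuous_cos.
exact: measurableT_comp mc mf.
Qed.

Let cosle (x : R) : `|cos x| <= 1.
Proof. by rewrite ler_norml cos_geN1 cos_le1. Qed.

Let Gcosle w x : `|G w * cos x| <= 1.
Proof.
have /andP[g0 g1] := G01 w; rewrite normrM (ger0_norm g0) -[leRHS]mulr1.
by rewrite ler_pM.
Qed.

Let iGcos b : P.-integrable setT (EFin \o (fun w => G w * cos (S b w))).
Proof.
apply: (@integrable_bounded _ _ _ _ _ 1) => //.
by apply: measurable_funM => //; exact: mcos.
Qed.

(** K m m is a variance; its sign is visible from the fact that the cosine transform
is largest at 0. *)
Lemma damping_diag_ge0 (m : nat) : (m < n)%N -> 0 <= K m m.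
Proof.
move=> mn; pose b0 : nat -> R := fun=> 0.
have q0 : quad n K b0 = 0.
  by rewrite /quad big1// => j _; rewrite big1// => k _; rewrite /b0 !mul0r.
have qm : quad n K (perturb b0 1 m) = K m m.
  rewrite quad_perturb// q0 add0r big1 ?mulr0 ?add0r ?expr1n ?mul1r// => j _.
  by rewrite /b0 mul0r.
have : C * expR (- K m m / 2) <= C * expR (- 0 / 2).
  rewrite -qm -[in leRHS]q0 -!GC; apply: le_Rintegral => //.
  move=> w _; have /andP[g0 _] := G01 w; rewrite ler_wpM2l//.
  by rewrite /S [in leRHS]big1 ?cos0 ?cos_le1// => k _; rewrite /b0 mul0r.
by rewrite ler_pM2l// ler_expR; lra.
Qed.

(** For a standard normal Z independent of Y, exp (- c Y_m ^ 2) is the mean of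
cos (a Y_m Z), where a ^ 2 = 2 c.  A product of two cosines shifts b by
+ a Z and - a Z in coordinate m; after exchanging the integrals, there remains a
Gaussian integral in Z. *)
Lemma gaussian_damping (c : R) (m : nat) : 0 <= c -> (m < n)%N -> forall b,
  \int[P]_w (G w * expR (- (c * Y m w ^+ 2)) * cos (S b w)) =
  C / Num.sqrt (1 + 2 * c * K m m) * expR (- quad n (damp K c m) b / 2).
Proof.
move=> c0 mn b; have K0 := damping_diag_ge0 mn.
pose a := Num.sqrt (2 * c).
have a2 : a ^+ 2 = 2 * c by rewrite sqr_sqrtr ?mulr_ge0.
pose Q : probability (measurableTypeR R) R := normal_prob 0 1.
pose F (z : T * measurableTypeR R) := G z.1 * cos (S b z.1) * cos (a * Y m z.1 * z.2).
have mF : measurable_fun setT F.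
  have mfst (f : T -> R) : measurable_fun setT f ->
      measurable_fun setT (fun z : T * measurableTypeR R => f z.1).
    by move=> mf; exact: measurableT_comp mf (@measurable_fst _ _ T (measurableTypeR R)).
  apply: measurable_funM.
    by apply: (mfst (fun w => G w * cos (S b w))); apply: measurable_funM => //; exact: mcos.
  have mc : measurable_fun setT (cos : R -> R).
    by apply: continuous_measurable_fun; exact: continuous_cos.
  apply: (measurableT_comp mc); apply: measurable_funM.
    by apply: (mfst (fun w => a * Y m w)); exact: measurable_funM.
  exact: (@measurable_snd _ _ T (measurableTypeR R)).
have Fle z : `|F z| <= 1.
  rewrite normrM -[leRHS]mulr1; apply: ler_pM => //.
transitivity (\int[P]_w \int[Q]_z F (w, z)).
  apply: eq_Rintegral => w _; rewrite /F/=.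
  transitivity (G w * cos (S b w) * \int[Q]_z cos (a * Y m w * z)).
    rewrite std_normal_cos exprMn a2 -!mulrA; congr (_ * _).
    by rewrite mulrC; congr (_ * expR (- _)); field.
  rewrite RintegralZl//; apply: (@integrable_bounded _ _ _ _ _ 1) => //.
  apply: continuous_measurable_fun => x; apply: continuous_comp; last exact: continuous_cos.
  by apply: cvgM; [exact: cvg_cst|exact: cvg_id].
rewrite (Rintegral_swap P Q mF Fle).
(* g 1 z and g (- 1) z are the inner means after linearizing the product of cosines. *)
pose beta := \sum_(j < n) b j * K j m.
pose g (e z : R) := C * expR (- quad n K (perturb b (e * a * z) m) / 2).
have inner z : \int[P]_w F (w, z) = 2^-1 * (g 1 z + g (- 1) z).
  have iGG b1 b2 : P.-integrable setT
      (EFin \o (fun w => G w * cos (S b1 w) + G w * cos (S b2 w))).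
    exact: (integrableD measurableT (iGcos b1) (iGcos b2)).
  rewrite /g -!GC -RintegralD// -RintegralZl//.
  apply: eq_Rintegral => w _; rewrite /F/=.
  have SE x : S (perturb b x m) w = S b w + x * Y m w.
    by rewrite /S (sum_perturb b (fun k => Y k w)).
  rewrite !SE mul1r mulN1r !mulNr (mulrAC a).
  by rewrite cosD cosB; field.
have gle e z : `|g e z| <= 1.
  rewrite /g -GC; apply: le_trans (le_normr_Rintegral _ _) _ => //.
  rewrite -[leRHS](Rintegral_cst_prob P 1); apply: le_Rintegral => //.
  - exact: integrable_norm (iGcos _).
  - exact: finite_measure_integrable_cst.
have gE e z : g e z = C * expR (- quad n K b / 2) *
    expR (- ((e * a * beta) * z) - (e ^+ 2 * a ^+ 2 * K m m) * z ^+ 2 / 2).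
  rewrite /g quad_perturb// -/beta -[RHS]mulrA -expRD; congr (_ * expR _).
  by field.
have mg e : measurable_fun setT (g e : measurableTypeR R -> R).
  have -> : g e = (fun z => C * expR (- quad n K b / 2) *
    expR (- ((e * a * beta) * z) - (e ^+ 2 * a ^+ 2 * K m m) * z ^+ 2 / 2)).
    by apply/funext => z; exact: gE.
  apply: continuous_measurable_fun => z; apply: cvgM; first exact: cvg_cst.
  apply: continuous_comp; last exact: continuous_expR.
  apply: cvgB; first by apply: cvgN; apply: cvgM; [exact: cvg_cst|exact: cvg_id].
  apply: cvgM; last exact: cvg_cst.
  by apply: cvgM; [exact: cvg_cst|exact: exprn_continuous].
have ig e : Q.-integrable setT (EFin \o g e).
  exact: (@integrable_bounded _ (measurableTypeR R) R Q (g e) 1 (mg e) (gle e)).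
have k0 : 0 <= 2 * c * K m m by rewrite !mulr_ge0.
have gI e : e ^+ 2 = 1 -> \int[Q]_z g e z = C * expR (- quad n K b / 2) *
    (expR (2 * c * beta ^+ 2 / (2 * (1 + 2 * c * K m m))) / Num.sqrt (1 + 2 * c * K m m)).
  move=> e2; rewrite /Q (std_normal_density (mg e) (gle e)).
  under eq_Rintegral do rewrite gE -mulrA e2 mul1r a2.
  rewrite RintegralZl//; last exact: normal_quadratic_integrable.
  by rewrite normal_quadratic// !exprMn e2 mul1r a2.
under eq_Rintegral do rewrite inner.
rewrite RintegralZl//; last exact: (integrableD measurableT (ig 1) (ig (- 1))).
rewrite RintegralD// !gI ?sqrrN ?expr1n// quad_damp -/beta.
have -> : expR (- (quad n K b - 2 * c / (1 + 2 * c * K m m) * beta ^+ 2) / 2) =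
    expR (- quad n K b / 2) * expR (2 * c * beta ^+ 2 / (2 * (1 + 2 * c * K m m))).
  by rewrite -expRD; congr expR; field; rewrite gt_eqF// ltr_pwDl.
by move: (expR _) (expR _) (Num.sqrt _)^-1 => x y z; field.
Qed.

End gaussian_damping.

Fixpoint damps {R : realType} (K : nat -> nat -> R) (c : nat -> R) (m : nat) :
    nat -> nat -> R :=
  if m is m'.+1 then damp (damps K c m') (c m') m' else K.

Fixpoint damps_det {R : realType} (K : nat -> nat -> R) (c : nat -> R) (m : nat) : R :=
  if m is m'.+1 then damps_det K c m' * (1 + 2 * c m' * damps K c m' m' m') else 1.

Lemma damps_sym {R : realType} (K : nat -> nat -> R) (c : nat -> R) (m : nat) :
  (forall j k, K j k = K k j) -> forall j k, damps K c m j k = damps K c m k j.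
Proof.
move=> Ksym; elim: m => [//|m IH] j k /=; rewrite /damp (IH j k).
by congr (_ - _ / _); ring.
Qed.

(** Adding the factors one at a time.  The masses multiply to the inverse square
root of the product [damps_det] of the pivots, which is the determinant of
1 + 2 K diag(c). *)
Lemma gaussian_damps {d} {T : measurableType d} {R : realType} (P : probability T R)
    (n : nat) (Y : nat -> T -> R) (K : nat -> nat -> R) (c : nat -> R) :
  (forall k, measurable_fun setT (Y k)) -> (forall j k, K j k = K k j) ->
  (forall k, 0 <= c k) ->
  (forall b : nat -> R, \int[P]_w cos (\sum_(k < n) b k * Y k w) = expR (- quad n K b / 2)) ->
  forall m, (m <= n)%N -> 0 < damps_det K c m /\
  forall b : nat -> R,
  \int[P]_w (expR (- \sum_(k < m) c k * Y k w ^+ 2) * cos (\sum_(k < n) b k * Y k w)) =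
  (Num.sqrt (damps_det K c m))^-1 * expR (- quad n (damps K c m) b / 2).
Proof.
move=> mY Ksym c0 KY; elim=> [|m IH] mn.
  split=> [//|b] /=; rewrite sqrtr1 invr1 mul1r -KY; apply: eq_Rintegral => w _.
  by rewrite big_ord0 oppr0 expR0 mul1r.
have [D0 {}IH] := IH (ltnW mn).
have mG : measurable_fun setT (fun w => expR (- \sum_(k < m) c k * Y k w ^+ 2)).
  apply: measurableT_comp => //; apply: measurableT_comp => //.
  by apply: measurable_sum => k; apply: measurable_funM => //; exact: measurable_funX.
have G01 w : 0 <= expR (- \sum_(k < m) c k * Y k w ^+ 2) <= 1.
  rewrite expR_ge0 -expR0 ler_expR oppr_le0 sumr_ge0// => k _.
  by rewrite mulr_ge0 ?sqr_ge0.
have C0 : 0 < (Num.sqrt (damps_det K c m))^-1 by rewrite invr_gt0 sqrtr_gt0.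
have sK := damps_sym c m Ksym.
have k0 := damping_diag_ge0 mY mG G01 sK C0 IH mn.
have f0 : 0 < 1 + 2 * c m * damps K c m m m by rewrite ltr_pwDl// !mulr_ge0.
split; first by rewrite /= mulr_gt0.
move=> b; have := gaussian_damping mY mG G01 sK C0 IH (c0 m) mn b.
rewrite /= sqrtrM ?(ltW D0)// invfM => <-.
apply: eq_Rintegral => w _; rewrite big_ord_recr/= opprD expRD.
by [].
Qed.

(** * The weighted bridge and the Euler scheme *)

Section bridge_damps.
Context {R : realType} (n : nat) (dt : R) (c : nat -> R).
Hypothesis dt0 : 0 < dt.
Hypothesis ndt : n.+1%:R * dt = 1.
Hypothesis c0 : forall k, 0 <= c k.

Let K := bridge_kernel 1 (fun k => k%:R * dt).

Let line m t : R := (euler dt c m).1 + (euler dt c m).2 * (t - m%:R * dt).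

(** With nonnegative masses the scheme is convex, hence above the line t. *)
Lemma euler_ge m : m%:R * dt <= (euler dt c m).1 /\ 1 <= (euler dt c m).2.
Proof.
elim: m => [|m [IH1 IH2]] /=; first by rewrite mul0r.
have p0 : 0 <= m%:R * dt by rewrite mulr_ge0// ltW.
have H1 : m.+1%:R * dt <= (euler dt c m).1 + dt * (euler dt c m).2.
  by rewrite -natr1 mulrDl mul1r lerD// ler_peMr// ltW.
split => //; rewrite -[leLHS]addr0 lerD// mulr_ge0 ?mulr_ge0//.
by apply: le_trans H1; rewrite mulr_ge0// ltW.
Qed.

Lemma time_le1 m : (m <= n.+1)%N -> m%:R * dt <= 1.
Proof. by move=> mn; rewrite -[leRHS]ndt ler_pM2r// ler_nat. Qed.

Let line1_gt0 m : (m <= n.+1)%N -> 0 < line m 1.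
Proof.
move=> mn; have [h1 h2] := euler_ge m; have t1 := time_le1 mn.
have h3 : 1 * (1 - m%:R * dt) <= (euler dt c m).2 * (1 - m%:R * dt).
  by rewrite ler_wpM2r// subr_ge0.
by rewrite /line; lra.
Qed.

(** The covariance of the bridge is s (1 - t) for s <= t.  Once the points up to
t_m have been weighted, at later times s <= t it is p s (1 - t) / p 1, where
p = [line m] is the affine function extending the Euler scheme after step m, and
the determinant is p 1.  The rank-one update at the next point changes the slope
of p there by 2 c p, exactly as the Euler scheme does. *)
Lemma bridge_damps m : (m <= n.+1)%N -> damps_det K c m.+1 = line m 1 /\
  forall j k, (m <= j)%N -> (j <= k)%N -> (k <= n.+1)%N ->
    damps K c m.+1 j k = line m (j%:R * dt) * (1 - k%:R * dt) / line m 1.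
Proof.
elim: m => [_|m IH mn].
  have K0 j : K j 0%N = 0.
    by rewrite /K /bridge_kernel mul0r mulr0 mul0r subr0 min_r// mulr_ge0// ltW.
  split => [|j k _ jk kn].
    by rewrite /= K0 /line /= mul0r; ring.
  rewrite /= /damp !K0 /line /=.
  by rewrite /K /bridge_kernel min_l ?ler_pM2r ?ler_nat// mul0r; field.
have [IH1 IH2] := IH (ltnW mn); have L0 := line1_gt0 (ltnW mn); have L1 := line1_gt0 mn.
set e := m.+1%:R * dt.
have pE : (euler dt c m.+1).1 = line m e.
  by rewrite /line /e /= -natr1; ring.
have lineE t : line m.+1 t = line m t + 2 * c m.+1 * line m e * (t - e).
  have sE : (euler dt c m.+1).2 = (euler dt c m).2 + 2 * c m.+1 * line m e by rewrite -pE.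
  by rewrite {1}/line pE sE -/e /line; ring.
have Ksym j k : K j k = K k j by rewrite /K /bridge_kernel minC (mulrC (j%:R * dt)).
have Ke k : (m < k)%N -> (k <= n.+1)%N ->
    damps K c m.+1 k m.+1 = line m e * (1 - k%:R * dt) / line m 1.
  by move=> mk kn; rewrite damps_sym// IH2.
have L1' : 0 < line m 1 + 2 * c m.+1 * line m e * (1 - e) by rewrite -lineE.
split => [|j k mj jk kn].
  rewrite [LHS]/= -/(damps_det K c m.+1) -/(damps K c m.+1) IH1 Ke// lineE -/e.
  by field; rewrite gt_eqF.
rewrite [LHS]/= -/(damps K c m.+1) /damp Ke// ?(leq_trans jk)// !Ke// ?(leq_trans mj)//.
rewrite IH2//; last exact: ltnW.
rewrite !lineE -/e.
set s := j%:R * dt; set t := k%:R * dt.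
(* Only the affinity of line m matters: it gives
   p 1 (s - e) = p s (1 - e) - p e (1 - s). *)
have affine x : line m x = line m e + (euler dt c m).2 * (x - e) by rewrite /line; ring.
move: L0 L1'; rewrite (affine s) (affine 1).
move: (line m e) (euler dt c m).2 => a b D0 D1.
by field; rewrite !gt_eqF//.
Qed.

End bridge_damps.

(** At the last step the time is 1 and the extension of the Euler scheme has no
room left, so the determinant is the position of the scheme itself. *)
Lemma bridge_riemann_laplace {d} {T : measurableType d} {R : realType} (P : probability T R)
    (B : R -> {RV P >-> R}) (n : nat) (c : nat -> R) :
  brownian_bridge 1 B -> (forall k, 0 <= c k) ->
  \int[P]_w expR (- \sum_(k < n.+2) c k * B (k%:R * n.+1%:R^-1) w ^+ 2) =
  (Num.sqrt (euler n.+1%:R^-1 c n.+1).1)^-1.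
Proof.
move=> bB c0; set dt : R := n.+1%:R^-1.
have dt0 : 0 < dt by rewrite invr_gt0.
have ndt : n.+1%:R * dt = 1 by rewrite mulfV.
pose K := bridge_kernel 1 (fun k => k%:R * dt).
have Ksym j k : K j k = K k j by rewrite /K /bridge_kernel minC (mulrC (j%:R * dt)).
have cosB (b : nat -> R) : \int[P]_w cos (\sum_(k < n.+2) b k * B (k%:R * dt) w) = expR (- quad n.+2 K b / 2).
  apply: (bridge_cos bB) => k kn; rewrite in_itv/= mulr_ge0 ?(ltW dt0)//=.
  exact: (time_le1 dt0 ndt).
have [_ ] := gaussian_damps (Y := fun k => B (k%:R * dt)) (fun k => @measurable_funPT _ _ _ _ (B (k%:R * dt))) Ksym c0 cosB (leqnn n.+2).
move=> /(_ (fun=> 0)).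
have [-> _] := bridge_damps dt0 ndt c0 (leqnn n.+1).
rewrite ndt subrr mulr0 addr0.
have -> : quad n.+2 (damps K c n.+2) (fun=> 0) = 0.
  by rewrite /quad big1// => j _; rewrite big1// => k _; rewrite !mul0r.
rewrite oppr0 mul0r expR0 mulr1 => <-; apply: eq_Rintegral => w _.
by rewrite [in cos _]big1 ?cos0 ?mulr1// => k _; rewrite mul0r.
Qed.

(** * The Laplace transform of the squared bridge *)

(** On a continuous path the Riemann sums converge, and the exponentials are
bounded by 1, so dominated convergence carries the discrete formula to the
limit.  The functional F is only prescribed on continuous paths: this covers
integrals against a measure as well as integrals after a change of time, and
F may be anything on the null set of discontinuous paths. *)
Lemma bridge_laplace {d} {T : measurableType d} {R : realType} (P : probability T R)
    (B : R -> {RV P >-> R}) (q : R -> R) (L : R) (F : (R -> R) -> R) :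
  brownian_bridge 1 B ->
  (forall b : R -> R, {within `[0, 1], continuous b} ->
     F b = \int[@lebesgue_measure R]_(t in `[0, 1]) (b t ^+ 2 * q t)) ->
  continuous q -> (forall x, 0 <= q x) ->
  0 < L ->
  (euler n.+1%:R^-1 (fun k => n.+1%:R^-1 * q (k%:R / n.+1%:R)) n.+1).1 @[n --> \oo] --> L ->
  ('E_P[fun w => expR (- F (B^~ w))%R] =
   ((Num.sqrt L)^-1)%:E)%E.
Proof.
move=> bB FE cq q0 L0 eL; have [_ _ _ [N [mN N0 NB]]] := bB.
rewrite unlock.
pose Z w := expR (- F (B^~ w)).
pose c n (k : nat) : R := n.+1%:R^-1 * q (k%:R / n.+1%:R).
pose Zn n w := expR (- \sum_(k < n.+2) c n k * B (k%:R * n.+1%:R^-1) w ^+ 2).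
have c0 n k : 0 <= c n k by rewrite mulr_ge0.
have mZn n : measurable_fun setT (Zn n).
  apply: measurableT_comp => //; apply: measurableT_comp => //.
  apply: measurable_sum => k; apply: measurable_funM => //.
  by apply: measurable_funX.
have Zn1 n w : `|Zn n w| <= 1.
  rewrite ger0_norm ?expR_ge0// -[leRHS]expR0 ler_expR oppr_le0.
  by apply: sumr_ge0 => k _; rewrite mulr_ge0// sqr_ge0.
have ZnZ w : ~ N w -> Zn n w @[n --> \oo] --> Z w.
  move=> Nw; have cB : {within `[0, 1], continuous (fun t => B t w)}.
    by apply: contra_notP Nw => ncB; exact: NB.
  have cBc := continuous_clamp ler01 cB.
  pose f t := (B (clamp 0 1 t) w) ^+ 2 * q t.
  have cf : continuous f.
    move=> x; apply: cvgM; last exact: cq.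
    by apply: (@continuous_comp _ _ _ _ (fun y : R => y ^+ 2)); [exact: cBc|exact: exprn_continuous].
  have fE : F (B^~ w) = \int[@lebesgue_measure R]_(t in `[0, 1]) f t.
    by rewrite FE//; apply: eq_Rintegral => t; rewrite inE => t01; rewrite /f clamp_id.
  rewrite /Z fE; apply: (@continuous_cvg _ _ _ _ _ _ expR); first exact: continuous_expR.
  apply: cvgN; rewrite [X in X @ _ --> _](_ : _ = fun n : nat => \sum_(k < n.+2) n.+1%:R^-1 * f (k%:R * n.+1%:R^-1)).
    exact: riemann_sum_cvg.
  apply/funext => n; apply: eq_bigr => k _; rewrite /f /c clamp_id; first by ring.
  rewrite in_itv/= mulr_ge0//= ler_pdivrMr// mul1r ler_nat.
  have := ltn_ord k; lia.
(* Y is a measurable modification of Z: a pointwise limit of measurable functions. *)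
pose Y w := if w \in N then 0 else Z w.
have mN' : measurable_fun setT (fun w => w \in N).
  by apply: (measurable_fun_bool true); rewrite setTI preimage_mem_true.
have mY : measurable_fun setT Y.
  apply: (measurable_fun_cvg (h := fun n w => if w \in N then 0 else Zn n w)) => [n|w _].
    exact: measurable_fun_ifT.
  rewrite /Y; case: ifPn => [_|/negP wN]; first exact: cvg_cst.
  by apply: ZnZ => Nw; apply: wN; rewrite inE.
have Y0 w : 0 <= Y w by rewrite /Y; case: ifP => // _; exact: expR_ge0.
have -> : (\int[P]_w (Z w)%:E = \int[P]_w (EFin \o Y) w)%E.
  apply: (integral_off_negligible mN N0) => [|w|w|w Nw].
  - exact/measurable_EFinP.
  - by rewrite lee_fin expR_ge0.
  - by rewrite lee_fin.
  - by rewrite /= /Y memNset.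
have i1 : P.-integrable setT (EFin \o cst (1 : R)).
  by apply: (@integrable_bounded _ _ _ P _ 1); [exact: measurable_cst|move=> w; rewrite normr1].
have mZn' n : measurable_fun setT (EFin \o Zn n) by exact/measurable_EFinP.
have mY' : measurable_fun setT (EFin \o Y) by exact/measurable_EFinP.
have ZnY : {ae P, forall w, setT w -> (EFin \o Zn n) w @[n --> \oo] --> (EFin \o Y) w}.
  exists N; split => // w /=; apply: contra_notP => Nw _.
  by rewrite /Y memNset//; apply: cvg_EFin; [exact: nearW|exact: ZnZ].
have Zn1' : {ae P, forall w n, setT w -> (`|(EFin \o Zn n) w| <= (EFin \o cst (1 : R)%R) w)%E}.
  by apply: aeW => w n _; rewrite /= lee_fin.
have [_ _] := dominated_convergence measurableT mZn' mY' ZnY i1 Zn1'.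
have ZE n : (\int[P]_w (EFin \o Zn n) w = ((Num.sqrt (euler n.+1%:R^-1 (c n) n.+1).1)^-1)%:E)%E.
  rewrite -(bridge_riemann_laplace n bB (c0 n)) /Rintegral fineK//.
  exact: integrable_fin_num (integrable_bounded P (mZn n) (Zn1 n)).
rewrite /= (eq_cvg _ _ ZE) => YL; apply: cvg_unique YL _ => //.
apply: cvg_EFin; first exact: nearW.
apply: cvgV; first by rewrite gt_eqF// sqrtr_gt0.
by apply: (@continuous_cvg _ _ _ _ _ _ Num.sqrt); [exact: sqrt_continuous|exact: eL].
Qed.

(** * Unit-speed curves *)

Section relative_calculus.
Context {R : realType} {V : normedModType R} (ip : {dot V for idfun}).
Hypothesis ip_norm : forall v : V, `|v| = Num.sqrt (ip v v).

Let ipC u v : ip u v = ip v u.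
Proof. by rewrite hermC/= expr0 mul1r. Qed.

Let ipDl u v w : ip (u + v) w = ip u w + ip v w.
Proof. exact: linearDl. Qed.

Let ipDr u v w : ip w (u + v) = ip w u + ip w v.
Proof. exact: linearDr. Qed.

Let ipNr u v : ip u (- v) = - ip u v.
Proof. exact: linearNr. Qed.

Let ipNl u v : ip (- u) v = - ip u v.
Proof. exact: linearNl. Qed.

Let ipZr u v a : ip u (a *: v) = a * ip u v.
Proof. exact: linearZr_LR. Qed.

Let ipZl u v a : ip (a *: u) v = a * ip u v.
Proof. exact: linearZl_LR. Qed.

Lemma dot_normE v : ip v v = `|v| ^+ 2.
Proof.
rewrite ip_norm sqr_sqrtr//; have [->|v0] := eqVneq v 0; first by rewrite linear0r.
exact: ltW (neq0_dnorm_gt0 _ v0).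
Qed.

Lemma dot_polarization u v : ip u v = (`|u + v| ^+ 2 - `|u - v| ^+ 2) / 4.
Proof.
by rewrite -!dot_normE !(ipDl, ipDr, ipNl, ipNr) (ipC v u); field.
Qed.

(** By polarization, the inner product inherits its continuity from the norm. *)
Lemma cvg_dot {U : Type} (F : set_system U) {FF : Filter F} (f g : U -> V) (a b : V) :
  f @ F --> a -> g @ F --> b -> ip (f x) (g x) @[x --> F] --> ip a b.
Proof.
move=> fa gb; rewrite dot_polarization; under eq_fun do rewrite dot_polarization.
have sq (h : U -> V) c : h @ F --> c -> `|h x| ^+ 2 @[x --> F] --> `|c| ^+ 2.
  by move=> hc; apply: (@continuous_cvg _ _ _ _ _ _ (fun y : R => y ^+ 2)); [exact: exprn_continuous|exact: cvg_norm].
by apply: cvgM; [apply: cvgB; apply: sq; [exact: cvgD|exact: cvgB]|exact: cvg_cst].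
Qed.

(** Limits of difference quotients relative to the interval, including those at
the end points, are unique. *)
Lemma dnbhs_itv_proper (l x : R) : 0 < l -> x \in `[0, l] ->
  ProperFilter (within `[0, l] x^').
Proof.
move=> l0; rewrite in_itv/= => /andP[x0 xl].
apply: Build_ProperFilter_ex => P -[e /= e0 eP].
pose d := Num.min e l / 2.
have d0 : 0 < d by rewrite divr_gt0// lt_min e0.
have de : d < e by rewrite ltr_pdivrMr// (le_lt_trans (y := e))// ?ge_min ?lexx//; lra.
have dl : d <= l / 2 by rewrite ler_pM2r// ge_min lexx orbT.
have [xl2|xl2] := leP x (l / 2).
  exists (x + d); apply: eP => /=.
  - by rewrite opprD addNKr normrN gtr0_norm.
  - by rewrite eq_sym -subr_eq0 opprD addNKr oppr_eq0 gt_eqF.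
  - by rewrite in_itv/=; apply/andP; split; lra.
exists (x - d); apply: eP => /=.
- by rewrite opprB addrCA subrr addr0 gtr0_norm.
- by rewrite eq_sym -subr_eq0 opprB addrCA subrr addr0 gt_eqF.
- by rewrite in_itv/=; apply/andP; split; lra.
Qed.

Lemma derivable_on_continuous (A : set R) (f : R -> V) : derivable_on A f ->
  {within A, continuous f}.
Proof.
move=> df; apply/subspace_continuousP => x Ax.
have {}df : diff_quot f x y @[y --> within A x^'] --> derive_on A f x by exact: df.
rewrite /from_subspace.
have fE : f x + (y - x) *: diff_quot f x y @[y --> within A x^'] --> f x.
  rewrite -[X in _ --> X]addr0 -(scale0r (derive_on A f x)).
  apply: cvgD; first exact: cvg_cst.
  apply: cvgZ => //; apply: cvg_within_filter; apply: cvg_within_filter.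
  have : y - x @[y --> x] --> x - x by apply: cvgB; [exact: cvg_id|exact: cvg_cst].
  by rewrite subrr.
apply/cvgrPdist_lt => e e0; move/cvgrPdist_lt : fE => /(_ e e0).
apply: (@filterS _ (nbhs x)) => y /= H Ay.
have [->|yx] := eqVneq y x; first by rewrite subrr normr0.
by have := H yx Ay; rewrite scalerA divff ?subr_eq0// scale1r subrKC.
Qed.

(** The product rule: the difference quotient of ip (f x) (g x), which is zero, is
split in the usual way. *)
Lemma derive_dot_cst (l a : R) (f g : R -> V) : 0 < l ->
  derivable_on `[0, l] f -> derivable_on `[0, l] g ->
  (forall x, x \in `[0, l] -> ip (f x) (g x) = a) ->
  forall x, x \in `[0, l] -> ip (derive_on `[0, l] f x) (g x) + ip (f x) (derive_on `[0, l] g x) = 0.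
Proof.
move=> l0 df dg fg x xl; have PF := dnbhs_itv_proper l0 xl.
have cg := derivable_on_continuous dg.
have xA : `[0, l]%classic x by [].
have {}df : diff_quot f x y @[y --> within `[0, l] x^'] --> derive_on `[0, l] f x by exact: df.
have {}dg : diff_quot g x y @[y --> within `[0, l] x^'] --> derive_on `[0, l] g x by exact: dg.
have gx : g y @[y --> within `[0, l] x^'] --> g x.
  have /subspace_continuousP/(_ _ xA) := cg.
  apply: cvg_trans; apply: cvg_app => B /=.
  by apply: (@filterS _ (nbhs x)) => y BAy yx Ay; exact: BAy.
have H : ip (diff_quot f x y) (g y) + ip (f x) (diff_quot g x y) @[y --> within `[0, l] x^'] -->
  ip (derive_on `[0, l] f x) (g x) + ip (f x) (derive_on `[0, l] g x).
  by apply: cvgD; apply: cvg_dot => //; exact: cvg_cst.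
apply: (cvg_unique _ H) => //.
apply: (@cvg_trans _ ((fun=> 0 : R) @ within `[0, l] x^')); last exact: cvg_cst.
apply: near_eq_cvg; near=> y.
have yA : y \in `[0, l] by near: y; exact: withinT.
rewrite /diff_quot ipZl ipZr -mulrDr !(ipDl, ipDr, ipNl, ipNr) !fg//.
by rewrite addrA subrK subrr mulr0.
Unshelve. all: end_near.
Qed.

(** Differentiating ip gamma' gamma' = 1 gives ip gamma' gamma'' = 0;
differentiating once more gives the claim. *)
Lemma unit_speed_third_derivative (l : R) (gamma : R -> V) : 0 < l ->
  continuously_derivable_on `[0, l] 3 gamma ->
  (forall s, s \in `[0, l] -> `|derive_on_n `[0, l] 1 gamma s| = 1) ->
  forall s, s \in `[0, l] ->
  ip (derive_on_n `[0, l] 1 gamma s) (derive_on_n `[0, l] 3 gamma s) =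
  - `|derive_on_n `[0, l] 2 gamma s| ^+ 2.
Proof.
move=> l0 [dg _] g1.
have d1 : derivable_on `[0, l] (derive_on_n `[0, l] 1 gamma) by exact: dg.
have d2 : derivable_on `[0, l] (derive_on_n `[0, l] 2 gamma) by exact: dg.
have ortho x : x \in `[0, l] ->
    ip (derive_on_n `[0, l] 1 gamma x) (derive_on_n `[0, l] 2 gamma x) = 0.
  have u1 y : y \in `[0, l] ->
      ip (derive_on_n `[0, l] 1 gamma y) (derive_on_n `[0, l] 1 gamma y) = 1.
    by move=> yl; rewrite dot_normE g1// expr1n.
  move=> xl; have := derive_dot_cst l0 d1 d1 u1 xl.
  rewrite -/(derive_on_n `[0, l] 2 gamma x) (ipC (derive_on_n _ 2 _ _)).
  by move: (ip _ _) => z; lra.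
move=> s sl; have := derive_dot_cst l0 d1 d2 ortho sl.
rewrite -/(derive_on_n `[0, l] 2 gamma s) dot_normE addrC => /eqP.
by rewrite addr_eq0 => /eqP.
Qed.

End relative_calculus.

(** * Rescaled bridges and the Hambly-Lyons limit *)

(** Brownian scaling: time is multiplied by l and space by the square root
of l. *)
Lemma bridge_rescale {d} {T : measurableType d} {R : realType} (P : probability T R) (l : R)
    (beta : R -> {RV P >-> R}) : 0 < l -> brownian_bridge l beta ->
  brownian_bridge 1 (fun t => scale_mfun (Num.sqrt l)^-1 (beta (t * l)) : {RV P >-> R}).
Proof.
move=> l0 bB; have [gB mB cB pB] := bB.
have in_l t : t \in `[0, 1] -> t * l \in `[0, l].
  by rewrite !in_itv/= => /andP[t0 t1]; rewrite mulr_ge0 ?(ltW l0)//= ler_piMl// ltW.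
have L1 t : t \in `[0, 1] -> (beta (t * l) : T -> R) \in Lfun P 1.
  by move=> t1; apply/Lfun1_integrable; exact: bridge_integrable bB _ (in_l _ t1).
have sl : Num.sqrt l ^+ 2 = l by rewrite sqr_sqrtr// ltW.
have L2 s t k : s \in `[0, 1] -> t \in `[0, 1] ->
    ((beta (s * l) : T -> R) * (k \o* beta (t * l)))%R \in Lfun P 1.
  move=> s1 t1; apply/Lfun1_integrable.
  have := integrableZl measurableT k (bridge_mul_integrable bB (in_l _ s1) (in_l _ t1)).
  congr (_.-integrable _ _); apply/funext => w /=; rewrite -EFinM; congr EFin.
  by rewrite mulrCA (mulrC k).
split.
- move=> n t a t01.
  have := gB n (fun i => t i * l) (fun i => a i * (Num.sqrt l)^-1) (fun i => in_l _ (t01 i)).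
  congr gaussian; apply/funext => w; apply: eq_bigr => i _ /=; ring.
- by move=> t t1; rewrite expectationZl ?L1// mB ?in_l// mule0.
- move=> s t s1 t1; rewrite covarianceZl ?L1 ?L2 ?Lfun_scale ?L1//.
  have := L2 s t 1 s1 t1; rewrite (_ : 1 \o* beta (t * l) = beta (t * l) :> (T -> R)); last first.
    by apply/funext => w /=; rewrite mulr1.
  move=> L3; rewrite covarianceZr ?L1// ?cB ?in_l// -!EFinM; congr EFin.
  rewrite -minr_pMl ?ltW//.
  set x := Num.min s t; rewrite mulrA -invfM -expr2 sl.
  by field; rewrite gt_eqF.
apply: filterS pB => w /= cw.
have cc := continuous_clamp (ltW l0) cw.
have : {within `[0, 1], continuous (fun t => beta (clamp 0 l (t * l)) w * (Num.sqrt l)^-1)}.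
  apply: continuous_subspaceT => t; apply: cvgM; last exact: cvg_cst.
  have ct : continuous (fun t : R => t * l).
    by move=> t'; apply: cvgM; [exact: cvg_id|exact: cvg_cst].
  exact: (@continuous_comp _ _ _ _ _ _ (ct t) (cc (t * l))).
apply: subspace_eq_continuous => t; rewrite inE => t1.
by rewrite /from_subspace clamp_id// in_l.
Qed.

(** The curve enters only through w = |gamma''| ^ 2 and k = ip gamma' gamma''' = - w.
Both expectations are instances of [bridge_laplace] with the same density q:
for beta, the substitution s = t l turns the integral over `[0, l] into one over
`[0, 1] for the rescaled bridge, with the factor l ^ 2 coming from ds = l dt and
from the scaling of beta ^ 2. *)
Lemma ode_bridge_laplace (R : realType) (l : R) (w k : R -> R)
    (mu : {finite_measure set (measurableTypeR R) -> \bar R}) :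
  0 < l -> {within `[0, l], continuous w} -> (forall s, 0 <= w s) ->
  (forall s, s \in `[0, l] -> k s = - w s) ->
  has_lebesgue_density mu (fun t => l ^+ 2 * w (t * l) * \1_`[0, 1] t) ->
  exists psi : R -> R,
  [/\ solves_ode mu psi,
      (forall psi2 : R -> R, solves_ode mu psi2 -> forall t, t \in `[0, 1] -> psi2 t = psi t),
      0 < psi 1 &
      forall (d : measure_display) (T : measurableType d) (P : probability T R),
        (forall B : R -> {RV P >-> R}, brownian_bridge 1 B ->
          'E_P[fun w => expR (- \int[mu]_(t in `[0, 1]) (B t w) ^+ 2)%R] =
          ((Num.sqrt (psi 1))^-1)%:E)%E /\
        (forall beta : R -> {RV P >-> R}, brownian_bridge l beta ->
          'E_P[fun w => expR (\int[@lebesgue_measure R]_(s in `[0, l]) (beta s w ^+ 2 * k s))%R] =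
          ((Num.sqrt (psi 1))^-1)%:E)%E].
Proof.
move=> hl cw w0 kE hmu.
have cwc := continuous_clamp (ltW hl) cw.
have [K K0 wK] := continuous_bounded_itv (ltW hl) cw.
pose q (t : R) := l ^+ 2 * w (clamp 0 l (t * l)).
have cl : continuous (fun t : R => t * l).
  by move=> t; apply: cvgM; [exact: cvg_id|exact: cvg_cst].
have cq : continuous q.
  by move=> t; apply: cvgM; [exact: cvg_cst|exact: (continuous_comp (cl t) (cwc _))].
have in_l t : t \in `[0, 1] -> t * l \in `[0, l].
  by rewrite !in_itv/= => /andP[t0 t1]; rewrite mulr_ge0 ?(ltW hl)//= ler_piMl// ltW.
have qM t : 0 <= q t <= l ^+ 2 * K.
  rewrite mulr_ge0 ?sqr_ge0//= ler_wpM2l ?sqr_ge0//.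
  by rewrite (le_trans (ler_norm _))// wK// clamp_itv// ltW.
have q0 t : 0 <= q t by have /andP[] := qM t.
have muq : has_lebesgue_density mu (fun t => q t * \1_`[0, 1] t).
  suff -> : (fun t => q t * \1_`[0, 1] t) = fun t => l ^+ 2 * w (t * l) * \1_`[0, 1] t by [].
  apply/funext => t; have [t01|t01] := boolP (t \in `[0, 1]).
    by rewrite /q clamp_id// in_l.
  by rewrite indicE memNset ?mulr0//; apply/negP.
have muE := integral_clipped_density cq q0 muq.
have muq01 (f : R -> R) : continuous f ->
    \int[mu]_(t in `]0, 1[) f t = \int[@lebesgue_measure R]_(t in `]0, 1[) (f t * q t).
  by move=> cf; apply: muE => //; exact: subset_itv_oo_cc.
have [psi [cpsi psiE psi_ge]] := volterra_fixpoint cq qM.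
have psi1 : 0 < psi 1 by rewrite (lt_le_trans ltr01)// psi_ge// ler01 lexx.
have eL := volterra_euler_cvg cq qM cpsi psiE.
exists psi; split => //.
- exact: (solves_ode_of_volterra cq muq01 cpsi psiE).
- move=> psi2 /(volterra_of_solves_ode cq muq01) [cpsi2 psi2E] t t01.
  by rewrite -(volterra_fixpoint_unique cq cpsi2 cpsi qM psi2E psiE) /= clamp_id.
have clip (b : R -> R) : {within `[0, 1], continuous b} -> continuous (fun t : R => b (clamp 0 1 t) ^+ 2).
  move=> cb t; apply: (@continuous_cvg _ _ _ _ _ _ (fun y : R => y ^+ 2)).
    exact: exprn_continuous.
  exact: (continuous_clamp ler01 cb).
move=> d T P; split=> [B bB|beta bbeta].
  pose F (b : R -> R) := \int[mu]_(t in `[0, 1]) (b t ^+ 2).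
  apply: (bridge_laplace (F := F) bB _ cq q0 psi1 eL) => b cb.
  transitivity (\int[mu]_(t in `[0, 1]) (b (clamp 0 1 t) ^+ 2)).
    by apply: eq_Rintegral => t; rewrite inE => t01; rewrite clamp_id.
  rewrite (muE _ _ _ _ (clip b cb))//.
  by apply: eq_Rintegral => t; rewrite inE => t01; rewrite clamp_id.
have sl : Num.sqrt l ^+ 2 = l by rewrite sqr_sqrtr// ltW.
have sl0 : Num.sqrt l != 0 by rewrite gt_eqF// sqrtr_gt0.
pose F (b : R -> R) := - \int[@lebesgue_measure R]_(s in `[0, l])
  ((Num.sqrt l * b (s / l)) ^+ 2 * k s).
have FE (b : R -> R) : {within `[0, 1], continuous b} ->
   F b = \int[@lebesgue_measure R]_(t in `[0, 1]) (b t ^+ 2 * q t).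
  move=> cb; have cbc := clip b cb.
  pose g (s : R) := b (clamp 0 1 (s / l)) ^+ 2 * (l * w (clamp 0 l s)).
  have cg : continuous g.
    have cil : continuous (fun t : R => t / l).
      by move=> t; apply: cvgM; [exact: cvg_id|exact: cvg_cst].
    move=> t; apply: cvgM; first exact: (continuous_comp (cil t) (cbc _)).
    by apply: cvgM; [exact: cvg_cst|exact: cwc].
  have -> : F b = \int[@lebesgue_measure R]_(s in `[0, l]) g s.
    rewrite /F; transitivity (- \int[@lebesgue_measure R]_(s in `[0, l]) (-1 * g s)).
      congr -%R; apply: eq_Rintegral => s; rewrite inE => s_in.
      have s01 : s / l \in `[0, 1].
        move: s_in; rewrite !in_itv/= => /andP[s0 sl'].
        by rewrite divr_ge0 ?(ltW hl)//= ler_pdivrMr// mul1r.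
      by rewrite /g kE// !clamp_id// exprMn sl; ring.
    rewrite RintegralZl ?mulN1r ?opprK//; exact: continuous_integrable.
  rewrite (Rintegral_rescale hl cg); apply: eq_Rintegral => t; rewrite inE => t01.
  rewrite /g /q mulfK ?gt_eqF// (clamp_id t01); ring.
rewrite -(bridge_laplace (bridge_rescale hl bbeta) FE cq q0 psi1 eL).
congr expectation; apply/funext => w'; congr expR; rewrite opprK.
apply: eq_Rintegral => s _ /=.
by rewrite divfK ?gt_eqF// mulrCA mulfV// mulr1.
Qed.

Theorem lemma24 (R : realType) (V : normedModType R)
    (ip : {dot V for idfun})
    (hV : finite_dimensional V)
    (hip : forall v : V, `|v| = Num.sqrt (ip v v))
    (l : R) (hl : 0 < l) (gamma : R -> V)
    (hgamma : continuously_derivable_on `[0, l] 3 gamma)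
    (hunit : forall s, s \in `[0, l] -> `|derive_on_n `[0, l] 1 gamma s| = 1)
    (mu : {finite_measure set (measurableTypeR R) -> \bar R})
    (hmu : has_lebesgue_density mu
       (fun t => l ^+ 2 * `|derive_on_n `[0, l] 2 gamma (t * l)| ^+ 2 *
                 \1_`[0, 1] t)) :
  exists psi : R -> R,
    [/\ solves_ode mu psi,
        (forall psi2 : R -> R, solves_ode mu psi2 ->
           forall t, t \in `[0, 1] -> psi2 t = psi t),
        0 < psi 1 &
        forall (d : measure_display) (T : measurableType d)
          (P : probability T R) (B : R -> {RV P >-> R}),
          brownian_bridge 1 B ->
          (((psi 1) `^ (- 4^-1))%:E =
             'E_P[fun w => expR (- \int[mu]_(t in `[0, 1]) (B t w) ^+ 2)%R]
             `^ (2^-1))%E /\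
          (forall (d' : measure_display) (T' : measurableType d')
             (P' : probability T' R) (beta : R -> {RV P' >-> R}),
             brownian_bridge l beta ->
             ('E_P[fun w => expR (- \int[mu]_(t in `[0, 1]) (B t w) ^+ 2)%R]
                `^ (2^-1) = hambly_lyons ip l beta gamma)%E)].
Proof.
pose w (s : R) := `|derive_on_n `[0, l] 2 gamma s| ^+ 2.
have cw : {within `[0, l], continuous w}.
  have gamma2c : {within `[0, l], continuous (derive_on_n `[0, l] 2 gamma)}.
    by apply: derivable_on_continuous; have [dg _] := hgamma; exact: (dg 2).
  move=> s; apply: (@continuous_cvg _ _ _ _ _ _ (fun y : R => y ^+ 2)); first exact: exprn_continuous.
  by apply: cvg_norm; exact: gamma2c.
have [psi [psi_ode psi_uniq psi1 psi_exp]] := ode_bridge_laplace hl cw (fun=> sqr_ge0 _)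
  (unit_speed_third_derivative hip hl hgamma hunit) hmu.
exists psi; split=> // d T P B bB.
have [/(_ B bB) -> _] := psi_exp d T P.
split.
  have -> : (Num.sqrt (psi 1))^-1 = psi 1 `^ (- 2^-1) by rewrite powRN powR12_sqrt// ltW.
  by rewrite poweR_EFin -powRrM; congr (_ `^ _)%:E; field.
move=> d' T' P' beta bbeta.
by rewrite /hambly_lyons; have [_ /(_ beta bbeta) ->] := psi_exp d' T' P'.
Qed.
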